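(* Suppose that $(u(x,t),\Theta(x,t),z(x,t))$ is a sufficiently smooth solution of $$-\operatorname{div}\big((1-z)^2\sigma^*[u,\Theta]\big)=0\quad\text{in }\Omega\times[0,T],$$ $$\alpha\frac{\partial z}{\partial t}=\Big(\epsilon\operatorname{div}(\gamma_*\nabla z)-\frac{\gamma_*}{\epsilon}z+(1-z)W(u)\Big)_+\quad\text{in }\Omega\times[0,T],$$ $$\chi\frac{\partial\Theta}{\partial t}=\operatorname{div}\big(\kappa(z)\nabla\Theta\big)-\Theta_0(1-z)^2\beta\frac{\partial}{\partial t}(\operatorname{div}u)\quad\text{in }\Omega\times(0,T],$$ with the boundary and initial conditions $$u=u_D\text{ on }\Gamma_D^u\times[0,T],\quad \sigma^*[u,\Theta]n=0\text{ on }\Gamma_N^u\times[0,T],\quad \Theta=\Theta_D\text{ on }\Gamma_D^\Theta\times[0,T],\quad \frac{\partial\Theta}{\partial n}=0\text{ on }\Gamma_N^\Theta\times[0,T],$$ $$\frac{\partial z}{\partial n}=0\text{ on }\Gamma\times[0,T],\quad z(\cdot,0)=z_*\text{ in }\Omega,\quad \Theta(\cdot,0)=\Theta_*\text{ in }\Omega .$$ If $u_D$ is independent of $t$ and $\Theta_D=\Theta_0$, then the following energy equality holds: $$\frac{d}{dt}\Big(\mathcal{E}_{el}(u(t),z(t))+E_s(z(t))+E_{th}(\Theta(t))\Big)=-\frac1{\Theta_0}\int_\Omega\kappa(z)|\nabla\Theta|^2\,dx-\alpha\int_\Omega|\dot z|^2\,dx\le0 .$$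
   Context: $\Omega\subset\mathbb{R}^d$ ($d=2$ or $3$) is a bounded domain with boundary $\Gamma=\partial\Omega$ and outward unit normal $n$, and $T>0$. $\Gamma=\Gamma_D^u\cup\Gamma_N^u$ with $\Gamma_D^u\cap\Gamma_N^u=\emptyset$, and $\Gamma=\Gamma_D^\Theta\cup\Gamma_N^\Theta$ with $\Gamma_D^\Theta\cap\Gamma_N^\Theta=\emptyset$; the $(d-1)$-dimensional volume of $\Gamma_D^u$ is positive. The unknowns are the displacement $u:\overline\Omega\times[0,T]\to\mathbb{R}^d$, the temperature $\Theta(x,t)\in\mathbb{R}$ and the damage variable $z:\overline\Omega\times[0,T]\to[0,1]$. The data $u_D,\Theta_D$ are boundary values and $z_*,\Theta_*$ initial values. $\dot z=\partial z/\partial t$; $u(t)=u(\cdot,t)$ etc.; $(s)_+:=\max(s,0)$. Constants: Lam\'e constants $\mu>0$, $\lambda>-\frac{2\mu}{d}$; $a_L>0$; $\beta:=a_L(d\lambda+2\mu)$; reference temperature $\Theta_0>0$; volumetric heat capacity $\chi>0$; regularization parameters $\alpha>0$, $\epsilon>0$; critical energy release rate $\gamma_*>0$ (constant). The thermal conductivity $\kappa=\kappa(z)>0$ is a given function of $z$. Strain and stress: $e[u]_{ij}=\frac12(\partial_{x_j}u_i+\partial_{x_i}u_j)$; $\sigma[u]:=\lambda(\operatorname{div}u)I+2\mu e[u]$; $\sigma^*[u,\Theta]:=\sigma[u]-\beta(\Theta-\Theta_0)I$, with $I$ the $d\times d$ identity; $A:B=\sum_{i,j}A_{ij}B_{ij}$;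 the divergence of a matrix field is row-wise. $W(u):=\sigma[u]:e[u]$. Energies: $$\mathcal{E}_{el}(u,z):=\frac12\int_\Omega(1-z)^2\sigma[u]:e[u]\,dx,\quad E_s(z):=\frac12\int_\Omega\gamma_*\Big(\epsilon|\nabla z|^2+\frac{|z|^2}{\epsilon}\Big)dx,\quad E_{th}(\Theta):=\frac{\chi}{2\Theta_0}\int_\Omega|\Theta(x)-\Theta_0|^2\,dx .$$ ''Sufficiently smooth'' means regular enough (including the boundary of the domain and the function $\kappa$) that all expressions make classical sense, one may differentiate under the integral sign in time, and Green's formula is valid for the fields involved. *)

(* Defs.v *)
From HB Require Import structures.
From mathcomp Require Import all_boot all_order all_algebra.
From mathcomp Require Import all_classical all_reals all_analysis.
From mathcomp Require Import measurable_realfun.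
Set Implicit Arguments. Unset Strict Implicit. Unset Printing Implicit Defensive.
Import Order.TTheory GRing.Theory Num.Theory.
Import numFieldNormedType.Exports.
Local Open Scope classical_set_scope.
Local Open Scope ring_scope.

Section borel_space.
Variable R : realType.

(* R^n with its Borel sigma-algebra. *)
Definition borel_rV (n : nat) := g_sigma_algebraType (@open 'rV[R]_n).

HB.instance Definition _ n := Measurable.on (borel_rV n).

Definition cons_rV n (p : measurableTypeR R * borel_rV n) : borel_rV n.+1 :=
  row_mx (p.1)%:M p.2.

Lemma cons_rV0 n p : (@cons_rV n p : 'rV[R]_n.+1) 0 0 = p.1.
Proof.
rewrite /cons_rV (_ : (0 : 'I_n.+1) = lshift n (0 : 'I_1)); last exact: val_inj.
by rewrite (row_mxEl (p.1)%:M p.2) mxE.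
Qed.

Lemma cons_rVS n p (i : 'I_n) :
  (@cons_rV n p : 'rV[R]_n.+1) 0 (lift 0 i) = (p.2 : 'rV[R]_n) 0 i.
Proof.
rewrite /cons_rV (_ : lift 0 i = rshift 1 i); last exact: val_inj.
by rewrite (row_mxEr (p.1)%:M p.2).
Qed.

Definition box n (a b : 'rV[R]_n) : set (borel_rV n) :=
  [set v : 'rV[R]_n | forall i, a 0 i <= v 0 i <= b 0 i].

(* Lebesgue measure on R^n, as an iterated product of the one on R;
   see [lebesgue_rV_box]. *)
Fixpoint lebesgue_rV (n : nat) : set (borel_rV n) -> \bar R :=
  if n is m.+1 then
    pushforward (@lebesgue_measure R \x @lebesgue_rV m)%E (@cons_rV m)
  else \d_((0 : 'rV[R]_0) : borel_rV 0).

Lemma open_measurable_rV n (U : set 'rV[R]_n) :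
  open U -> measurable (U : set (borel_rV n)).
Proof. exact: sub_sigma_algebra. Qed.

Lemma closed_measurable_rV n (A : set 'rV[R]_n) :
  closed A -> measurable (A : set (borel_rV n)).
Proof.
move=> cA; rewrite -(setCK A); apply: measurableC.
by apply: open_measurable_rV; exact: closed_openC.
Qed.

Lemma measurable_box n (a b : 'rV[R]_n) : measurable (box a b).
Proof.
apply: closed_measurable_rV.
rewrite [X in closed X](_ : _ =
    \bigcap_i ((fun v : 'rV[R]_n => v 0 i) @^-1` `[a 0 i, b 0 i])); last first.
  apply/seteqP; split => v /= h.
    by move=> i _ /=; rewrite in_itv/=; exact: h.
  by move=> i; have := h i Logic.I; rewrite /= in_itv.
apply: closed_bigI => i _; apply: preimage_closed => //.
- by move=> v _; exact: (@coord_continuous R 1 n 0 i).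
- exact: itv_closed.
Qed.

Lemma measurable_cons_rV n : measurable_fun setT (@cons_rV n).
Proof.
apply: (@measurability _ _ (measurableTypeR R * borel_rV n)%type (borel_rV n.+1) _ _ (@open (matrix R 1 n.+1))) => //.
move=> _ [U oU <-]; rewrite setTI.
pose c (x : 'rV[rat]_n.+1) : 'rV[R]_n.+1 := map_mx ratr x.
have UE : U = \bigcup_(p : 'rV[rat]_n.+1 * nat)
   (if pselect (ball (c p.1) (p.2.+1%:R^-1) `<=` U) then
     ball (c p.1) (p.2.+1%:R^-1) else set0).
  apply/seteqP; split => [y Uy|y [p _]]; last by case: pselect => // h /h.
  have /nbhs_ballP[e /= e0 yeU] : nbhs y U by exact: open_nbhs_nbhs.
  have [k ke] : exists k : nat, k.+1%:R^-1 < e / 2.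
    have e20 : 0 < e / 2 by rewrite divr_gt0.
    near \oo => k; exists k; near: k; exact: near_infty_natSinv_lt (PosNum e20).
  have k0 : 0 < k.+1%:R^-1 :> R by rewrite invr_gt0.
  have hq i : exists q : rat, ball (ratr q : R) (k.+1%:R^-1) (y 0 i).
    have /rat_in_itvoo[q] : y 0 i - k.+1%:R^-1 < y 0 i + k.+1%:R^-1.
      by rewrite ltrBlDr -addrA ltrDl addr_gt0.
    rewrite in_itv/= => /andP[h1 h2]; exists q.
    by rewrite /ball/= ltr_norml ltrBrDr addrC h1/= ltrBlDr addrC.
  have [q hq'] := choice hq.
  pose x := \row_i q i.
  have bx : ball (c x) (k.+1%:R^-1) y.
    split => // i j; rewrite !mxE (ord1 i); exact: hq'.
  exists (x, k) => //=; case: pselect => // -[] z bz; apply: yeU.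
  apply: (le_ball (e1 := k.+1%:R^-1 + k.+1%:R^-1)).
    by rewrite (splitr e) ltW// ltrD.
  by apply: ball_triangle; [exact: ball_sym bx|].
rewrite UE preimage_bigcup; apply: countable_bigcupT_measurable => // -[x k] /=.
case: pselect => [h|h] /=; last by rewrite preimage_set0; exact: measurable0.
rewrite [X in measurable X](_ : _ = ball (c x 0 0) (k.+1%:R^-1) `*`
   (ball (\row_i c x 0 (lift 0 i)) (k.+1%:R^-1) : set (borel_rV n))).
  apply: measurableX; first exact: open_measurable (ball_open _ _).
  exact: open_measurable_rV (ball_open _ _).
apply/seteqP; split => [p /= [k0 hp]|p /= [h1 [k0 h2]]].
  split; first by have := hp 0 0; rewrite cons_rV0.
  apply: (conj k0) => i j; rewrite (ord1 i) [X in ball X]mxE -cons_rVS; exact: hp.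
apply: (conj k0) => i j; rewrite (ord1 i); case: (unliftP 0 j) => [j'|] ->.
  by have := h2 0 j'; rewrite [X in ball X]mxE -cons_rVS.
by rewrite cons_rV0.
Unshelve. all: by end_near. Qed.


Section sigma_finite_of.
Variables (d : measure_display) (T : measurableType d).

Definition with_sigma_finite (m : {measure set T -> \bar R})
  (sfm : sigma_finite setT m) : set T -> \bar R := m.

Variables (m : {measure set T -> \bar R}) (sfm : sigma_finite setT m).
HB.instance Definition _ := Measure.on (with_sigma_finite sfm).
HB.instance Definition _ :=
  @Measure_isSigmaFinite.Build _ _ _ (with_sigma_finite sfm) sfm.

Definition sigma_finite_of : {sigma_finite_measure set T -> \bar R} :=
  with_sigma_finite sfm.

End sigma_finite_of.

Lemma lebesgue_rV_subproof n :
  exists2 m : {measure set (borel_rV n) -> \bar R}, @lebesgue_rV n = m &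
  forall a b : 'rV[R]_n, (forall i, a 0 i <= b 0 i) ->
    m (box a b) = (\prod_i (b 0 i - a 0 i))%:E.
Proof.
elim: n => [|n [m mE mbox]].
  exists (\d_((0 : 'rV[R]_0) : borel_rV 0)) => // a b ab.
  rewrite big_ord0; transitivity (\d_((0 : 'rV[R]_0) : borel_rV 0) (box a b) : \bar R); first by [].
  by rewrite diracE mem_set// => -[].
have sfm : sigma_finite setT m.
  exists (fun k => box (const_mx (- k%:R)) (const_mx k%:R)).
    apply/seteqP; split => // v _.
    near \oo => k; exists k => // i; rewrite !mxE -ler_norml.
    apply: (@le_trans _ _ `|v : 'rV[R]_n|); last first.
      by near: k; exact: nbhs_infty_ger.
    rewrite [leRHS]/Num.norm/= mx_normrE.
    exact: (le_bigmax _ (fun ij => `|(v : 'rV[R]_n) ij.1 ij.2|) (0, i)).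
  move=> k; split; first exact: measurable_box.
  rewrite mbox ?ltry// => i; rewrite !mxE.
  by rewrite (@le_trans _ _ 0)// oppr_le0.
pose m' := sigma_finite_of sfm.
exists (pushforward (@lebesgue_measure R \x m')%E (@cons_rV n)).
  by rewrite /= mE.
move=> a b ab; rewrite /pushforward.
pose tl (v : 'rV[R]_n.+1) := \row_i v 0 (lift 0 i).
have E : @cons_rV n @^-1` box a b = `[a 0 0, b 0 0] `*` box (tl a) (tl b).
  apply/seteqP; split => [p /= h|p /= [h1 h2] i].
    split; first by have := h 0; rewrite cons_rV0 in_itv.
    by move=> i; rewrite !mxE -cons_rVS; exact: h.
  case: (unliftP 0 i) => [j|] ->; last by rewrite cons_rV0; move: h1; rewrite in_itv.
  by have h2j := h2 j; rewrite !mxE in h2j; rewrite cons_rVS.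
etransitivity; first exact: (congr1 (@lebesgue_measure R \x m')%E E).
have mtl : m (box (tl a) (tl b)) = (\prod_i (b 0 (lift 0 i) - a 0 (lift 0 i)))%:E.
  rewrite mbox => [|i]; last by rewrite !mxE.
  by congr (_%:E); apply: eq_bigr => i _; rewrite !mxE.
rewrite product_measure1E; [|exact: measurable_itv|exact: measurable_box].
rewrite [X in (_ * X)%E]mtl big_ord_recl EFinM; congr (_ * _)%E.
rewrite [LHS]lebesgue_measure_itv/= lte_fin EFinB.
by have := ab 0; rewrite le_eqVlt => /orP[/eqP ->|->//]; rewrite ltxx subee.
Unshelve. all: try by end_near. all: exact: measurable_cons_rV. Qed.

Let lebesgue_rV0 n : @lebesgue_rV n set0 = 0%E.
Proof. by have [m -> _] := lebesgue_rV_subproof n. Qed.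

Let lebesgue_rV_ge0 n A : (0 <= @lebesgue_rV n A)%E.
Proof. by have [m -> _] := lebesgue_rV_subproof n. Qed.

Let lebesgue_rV_sigma_additive n : semi_sigma_additive (@lebesgue_rV n).
Proof.
have [m -> _] := lebesgue_rV_subproof n; exact: measure_semi_sigma_additive.
Qed.

HB.instance Definition _ n := isMeasure.Build _ _ _ (@lebesgue_rV n)
  (@lebesgue_rV0 n) (@lebesgue_rV_ge0 n) (@lebesgue_rV_sigma_additive n).

Lemma lebesgue_rV_box n (a b : 'rV[R]_n) : (forall i, a 0 i <= b 0 i) ->
  lebesgue_rV (box a b) = (\prod_i (b 0 i - a 0 i))%:E.
Proof.
by have [m mE mbox] := lebesgue_rV_subproof n => ab; rewrite mE; exact: mbox.
Qed.

End borel_space.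
Arguments lebesgue_rV {R} n.

Section euclidean.
Context {R : realType} {n : nat}.
Implicit Types (v w : 'rV[R]_n) (A : set 'rV[R]_n).

Definition dotv v w : R := \sum_i v 0 i * w 0 i.

(* The library norm on 'rV[R]_n is the maximum norm. *)
Definition enorm v : R := Num.sqrt (dotv v v).

Definition ddot (A B : 'M[R]_n) : R := \sum_i \sum_j A i j * B i j.

(* Meaningful for sets of bounded diameter ([sup] is 0 on unbounded sets). *)
Definition diam A : R :=
  sup [set r | exists x y, [/\ A x, A y & r = enorm (x - y)]].

Definition boundary A : set 'rV[R]_n := closure A `\` A°.

End euclidean.

(* The s-dimensional Hausdorff measure (s > 0), normalized so that it is the
   s-dimensional volume on smooth s-dimensional surfaces. *)
Section hausdorff.
Context {R : realType} {n : nat}.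
Implicit Types (A : set 'rV[R]_n) (F : (set 'rV[R]_n)^nat).

Definition unit_ball_volume (s : nat) : R :=
  fine (lebesgue_rV s [set v : 'rV[R]_s | enorm v <= 1]).

Definition fine_cover (delta : R) A : set ((set 'rV[R]_n)^nat) :=
  [set F | A `<=` \bigcup_k F k /\
     forall k x y, F k x -> F k y -> enorm (x - y) <= delta].

Definition hausdorff_pre (s : nat) (delta : R) A : \bar R :=
  ereal_inf [set (\sum_(k <oo) (unit_ball_volume s * (diam (F k) / 2) ^+ s)%:E)%E
            | F in fine_cover delta A].

Definition hausdorff (s : nat) (A : set (borel_rV R n)) : \bar R :=
  ereal_sup [set hausdorff_pre s delta A | delta in [set delta | 0 < delta]].

End hausdorff.

Section space_operators.
Context {R : realType} {d : nat}.
Implicit Types (Omega : set 'rV[R]_d) (f : 'rV[R]_d -> R)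
  (F : 'rV[R]_d -> 'rV[R]_d) (A : 'rV[R]_d -> 'M[R]_d).

Definition pd (i : 'I_d) f (x : 'rV[R]_d) : R := 'D_(delta_mx 0 i) f x.

Definition grad f x : 'rV[R]_d := \row_i pd i f x.

Definition div F x : R := \sum_i pd i (fun y => F y 0 i) x.

Definition divM A x : 'rV[R]_d := \row_i div (fun y => row i (A y)) x.

(* Boundary values of functions given in the open set Omega: their continuous
   extension to the closure of Omega. *)
Definition has_trace Omega f (x : 'rV[R]_d) := cvg (f y @[y --> within Omega (nbhs x)]).

Definition trace Omega f (x : 'rV[R]_d) : R := lim (f y @[y --> within Omega (nbhs x)]).

Definition C1_closure Omega f : Prop :=
  (forall x, closure Omega x -> has_trace Omega f x) /\
  forall i, (forall x, Omega x -> derivable f x (delta_mx 0 i)) /\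
            (forall x, closure Omega x -> has_trace Omega (pd i f) x).

(* [nu] is the outward unit normal at [x]: near [x], up to arbitrarily thin
   cones around the tangent hyperplane, Omega lies on the side of - nu and the
   complement of its closure on the side of nu. *)
Definition is_outward_normal Omega (x nu : 'rV[R]_d) : Prop :=
  enorm nu = 1 /\
  forall eps : R, 0 < eps -> \forall y \near x,
    (dotv (y - x) nu < - (eps * enorm (y - x)) -> Omega y) /\
    (eps * enorm (y - x) < dotv (y - x) nu -> ~ closure Omega y).

(* The outward unit normal field; it takes the value 0 at the points (corners,
   edges) where there is no normal. *)
Definition normal Omega (x : 'rV[R]_d) : 'rV[R]_d :=
  xget 0 [set nu | is_outward_normal Omega x nu].

Definition normal_derivative Omega f x : R :=
  \sum_i trace Omega (pd i f) x * normal Omega x 0 i.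

(* The value at a boundary point [x] of the vector A n. *)
Definition normal_flux Omega A x : 'rV[R]_d :=
  \row_i \sum_j trace Omega (fun y => A y i j) x * normal Omega x 0 j.

Definition vol_integral Omega f : R := \int[lebesgue_rV d]_(x in Omega) f x.

Definition surface_integral Omega f : R :=
  fine (\int[@hausdorff R d d.-1]_(x in boundary Omega) (f x)%:E).

Definition green_formula Omega : Prop :=
  forall F, (forall i, C1_closure Omega (fun x => F x 0 i)) ->
    vol_integral Omega (div F) =
    surface_integral Omega
      (fun x => \sum_i trace Omega (fun y => F y 0 i) x * normal Omega x 0 i).

(* A bounded domain with a boundary regular enough for Green's formula: the
   boundary has finite area and an outward unit normal almost everywhere. *)
Record regular_domain Omega : Prop := {
  domain_open : open Omega;
  domain_connected : connected Omega;
  domain_nonempty : Omega !=set0;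
  domain_bounded : bounded_set Omega;
  domain_area : (hausdorff d.-1 (boundary Omega) < +oo)%E;
  domain_normal : hausdorff d.-1
    [set x | boundary Omega x /\ ~ exists nu, is_outward_normal Omega x nu] = 0%E;
  domain_green : green_formula Omega }.

End space_operators.

Section time_and_regularity.
Context {R : realType} {d : nat}.
Variables (Omega : set 'rV[R]_d) (T : R).

(* The time derivative within [0, T], i.e. one-sided at t = 0 and t = T. *)
Definition time_quotient (f : R -> R) (t s : R) : R := (f s - f t) / (s - t).

Definition has_tderive (f : R -> R) (t l : R) : Prop :=
  time_quotient f t s @[s --> within `[0, T] t^'] --> l.

Definition tderivable (f : R -> R) (t : R) : Prop :=
  cvg (time_quotient f t s @[s --> within `[0, T] t^']).

Definition tderive (f : R -> R) (t : R) : R :=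
  lim (time_quotient f t s @[s --> within `[0, T] t^']).

(* [g], given on [0, T] x Omega, extends continuously to [0, T] x closure Omega. *)
Definition extends_continuously (g : R -> 'rV[R]_d -> R) : Prop :=
  forall (t : R) (x : 'rV[R]_d), 0 <= t <= T -> closure Omega x ->
    cvg (g p.1 p.2 @[p --> within (`[0, T] `*` Omega) (nbhs (t, x))]).

Definition dt (f : R -> 'rV[R]_d -> R) (t : R) (x : 'rV[R]_d) : R :=
  tderive (f ^~ x) t.

(* Of class C^1 in time and C^2 in space up to the boundary. *)
Record smooth_C21 (f : R -> 'rV[R]_d -> R) : Prop := {
  C21_continuous :
    {within `[0, T] `*` closure Omega, continuous (fun p => f p.1 p.2)};
  C21_pd : forall i (t : R) (x : 'rV[R]_d), 0 <= t <= T -> Omega x ->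
    derivable (f t) x (delta_mx 0 i);
  C21_pd_cont : forall i, extends_continuously (fun t => pd i (f t));
  C21_pd2 : forall i j (t : R) (x : 'rV[R]_d), 0 <= t <= T -> Omega x ->
    derivable (pd j (f t)) x (delta_mx 0 i);
  C21_pd2_cont : forall i j,
    extends_continuously (fun t => pd i (pd j (f t)));
  C21_dt : forall (t : R) (x : 'rV[R]_d), 0 <= t <= T -> Omega x -> tderivable (f ^~ x) t;
  C21_dt_cont : extends_continuously (dt f) }.

(* In addition, the gradient has a time derivative that is continuous up to the
   boundary. *)
Record smooth_mixed (f : R -> 'rV[R]_d -> R) : Prop := {
  mixed_C21 : smooth_C21 f;
  mixed_dt_pd : forall i (t : R) (x : 'rV[R]_d), 0 <= t <= T -> Omega x ->
    tderivable (fun s => pd i (f s) x) t;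
  mixed_dt_pd_cont : forall i,
    extends_continuously (dt (fun s => pd i (f s))) }.

End time_and_regularity.

Section elasticity.
Context {R : realType} {d : nat}.
Implicit Types (u : 'rV[R]_d -> 'rV[R]_d) (Th z : 'rV[R]_d -> R).

Definition strain u x : 'M[R]_d :=
  \matrix_(i, j) (2^-1 * (pd j (fun y => u y 0 i) x + pd i (fun y => u y 0 j) x)).

Definition stress (lambda mu : R) u x : 'M[R]_d :=
  (lambda * div u x)%:M + (2 * mu) *: strain u x.

Definition thermal_stress (lambda mu beta Theta0 : R) u Th x : 'M[R]_d :=
  stress lambda mu u x - (beta * (Th x - Theta0))%:M.

Definition energy_density (lambda mu : R) u x : R :=
  ddot (stress lambda mu u x) (strain u x).

Definition elastic_energy Omega (lambda mu : R) u z : R :=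
  2^-1 * vol_integral Omega
    (fun x => (1 - z x) ^+ 2 * energy_density lambda mu u x).

Definition surface_energy Omega (gamma eps : R) z : R :=
  2^-1 * vol_integral Omega
    (fun x => gamma * (eps * enorm (grad z x) ^+ 2 + `|z x| ^+ 2 / eps)).

Definition thermal_energy Omega (chi Theta0 : R) Th : R :=
  chi / (2 * Theta0) * vol_integral Omega (fun x => `|Th x - Theta0| ^+ 2).

End elasticity.

(* Main.v *)
Require Import Defs.
From mathcomp Require Import all_boot all_order all_algebra.
From mathcomp Require Import all_classical all_reals all_analysis.
From mathcomp Require Import measurable_realfun ring lra.
Set Implicit Arguments. Unset Strict Implicit. Unset Printing Implicit Defensive.
Import Order.TTheory GRing.Theory Num.Theory.
Import numFieldNormedType.Exports.
Local Open Scope classical_set_scope.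
Local Open Scope ring_scope.

(** The proof differentiates each energy in time and lets the field equations,
    tested with the right quantities, cancel everything but the dissipation.

    Write W for the elastic density, D for the time derivative of div u, and a
    prime for other time derivatives. By the product rule the elastic energy
    has derivative - int (1-z) W z' + int (1-z)^2 sigma[u] : e[u]', and the
    second integral is beta int (1-z)^2 (Theta - Theta_0) D, because the thermal
    stress does no work: the equilibrium equation is tested with u(s) - u(t),
    which vanishes where u is prescribed, while the rest of the boundary is free
    of traction; so int (1-z(t))^2 sigma^*(t) : grad u(s) is constant in s
    ([stress_power_eq0], [elastic_tderive]). The surface energy has derivative
    int z' (gamma/eps z - eps gamma Lap z) ([surface_tderive]); adding the
    first elastic term gives - int z' B, where B is the expression whose
    positive part is alpha z', and z' B = alpha z'^2 ([positive_part_sqr]).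
    The thermal energy has derivative chi/Theta_0 int (Theta - Theta_0) Theta'
    ([thermal_tderive]); the heat equation and an integration by parts
    ([conduction_by_parts]) turn it into minus the conduction dissipation
    minus beta int (1-z)^2 (Theta - Theta_0) D, which cancels the thermal work
    left over from the elastic part.

    No mixed derivative of z is at hand, and the space derivatives of the time
    derivative of u are not either. Both are avoided in the same way: Green's
    formula is applied to differences of two times before the quotient is
    taken to its limit. For z this writes
    int (|grad z(s)|^2 - |grad z(t)|^2) as
    - int (z(s) - z(t)) (Lap z(s) + Lap z(t)), where only difference quotients
    of z itself occur ([dirichlet_tderive]).

    The passage to the limit under the integral rests on compactness rather
    than on dominated convergence: a function of time and space that converges
    jointly in (s, y) near every point of the compact closure of the domain
    converges uniformly in space ([vol_integral_cvg]). Difference quotients of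
    a field with a time derivative that is continuous up to the boundary
    converge jointly by the mean value theorem ([tdiff_of_dt]). *)

(** * Boundary traces *)

Lemma cvg_sumr {R : realType} {T : Type} (F : set_system T) {FF : Filter F}
    (I : finType) (f : I -> T -> R) (l : I -> R) :
  (forall i, f i x @[x --> F] --> l i) ->
  (\sum_i f i x) @[x --> F] --> \sum_i l i.
Proof. by move=> h; apply: cvg_big => //; exact: add_continuous. Qed.

Section trace_calculus.
Context {R : realType} {d : nat} (Omega : set 'rV[R]_d).
Implicit Types (f g : 'rV[R]_d -> R) (x : 'rV[R]_d).

(** When Omega is open and bounded, such an f is on Omega the restriction of a
    continuous function on the compact closure; this makes it bounded,
    measurable and integrable. *)
Definition traced f := forall x, closure Omega x -> has_trace Omega f x.

Lemma closure_within x : closure Omega x -> ProperFilter (within Omega (nbhs x)).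
Proof. by move=> cx; apply: within_nbhs_proper. Qed.

Lemma trace_unique f x l : closure Omega x ->
  f y @[y --> within Omega (nbhs x)] --> l -> trace Omega f x = l.
Proof. by move=> /closure_within ?; apply: cvg_lim. Qed.

Lemma near_within_Omega x (P : 'rV[R]_d -> Prop) :
  (forall y, Omega y -> P y) -> \forall y \near within Omega (nbhs x), P y.
Proof. by move=> h; apply: filterS (withinT _ _) => y /h. Qed.

Lemma has_trace_ext f g x : (forall y, Omega y -> f y = g y) ->
  has_trace Omega f x -> has_trace Omega g x.
Proof.
move=> fg hf; apply/cvg_ex; exists (trace Omega f x).
apply: cvg_trans hf; apply: near_eq_cvg.
by apply: near_within_Omega => y /fg.
Qed.

Lemma has_trace_cst (c : R) x : has_trace Omega (fun=> c) x.
Proof. by apply/cvg_ex; exists c; exact: cvg_cst. Qed.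

Lemma has_traceD f g x : has_trace Omega f x -> has_trace Omega g x ->
  has_trace Omega (fun y => f y + g y) x.
Proof. by move=> hf hg; apply: is_cvgD. Qed.

Lemma has_traceM f g x : has_trace Omega f x -> has_trace Omega g x ->
  has_trace Omega (fun y => f y * g y) x.
Proof. by move=> hf hg; apply: is_cvgM. Qed.

Lemma has_trace_sum (I : finType) (F : I -> 'rV[R]_d -> R) x :
  (forall i, has_trace Omega (F i) x) ->
  has_trace Omega (fun y => \sum_i F i y) x.
Proof.
move=> h; apply/cvg_ex; exists (\sum_i trace Omega (F i) x).
by apply: cvg_sumr => i; exact: h.
Qed.

Lemma has_trace_comp (k : R -> R) f x : continuous k -> has_trace Omega f x ->
  has_trace Omega (k \o f) x.
Proof.
move=> ck hf; apply/cvg_ex; exists (k (trace Omega f x)).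
by apply: continuous_cvg; [exact: ck|exact: hf].
Qed.

Section trace_eq.
Variable x : 'rV[R]_d.
Hypothesis clx : closure Omega x.

Lemma traceD f g : has_trace Omega f x -> has_trace Omega g x ->
  trace Omega (fun y => f y + g y) x = trace Omega f x + trace Omega g x.
Proof. by move=> hf hg; apply: trace_unique => //; apply: cvgD. Qed.

Lemma traceM f g : has_trace Omega f x -> has_trace Omega g x ->
  trace Omega (fun y => f y * g y) x = trace Omega f x * trace Omega g x.
Proof. by move=> hf hg; apply: trace_unique => //; apply: cvgM. Qed.

Lemma trace_sum (I : finType) (F : I -> 'rV[R]_d -> R) :
  (forall i, has_trace Omega (F i) x) ->
  trace Omega (fun y => \sum_i F i y) x = \sum_i trace Omega (F i) x.
Proof. by move=> h; apply: trace_unique => //; apply: cvg_sumr => i; exact: h. Qed.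

End trace_eq.

Lemma tracedM f g : traced f -> traced g -> traced (fun y => f y * g y).
Proof. by move=> hf hg x cx; apply: has_traceM; [exact: hf|exact: hg]. Qed.

Lemma tracedD f g : traced f -> traced g -> traced (fun y => f y + g y).
Proof. by move=> hf hg x cx; apply: has_traceD; [exact: hf|exact: hg]. Qed.

Lemma traced_cst c : traced (fun=> c).
Proof. by move=> x _; exact: has_trace_cst. Qed.

Lemma tracedB f g : traced f -> traced g -> traced (fun y => f y - g y).
Proof.
move=> hf hg.
rewrite [X in traced X](_ : _ = fun y => f y + (-1) * g y); last by apply/funext => y; ring.
by apply: tracedD => //; apply: tracedM => //; exact: traced_cst.
Qed.

Lemma traced_sum (I : finType) (F : I -> 'rV[R]_d -> R) :
  (forall i, traced (F i)) -> traced (fun y => \sum_i F i y).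
Proof. by move=> h x cx; apply: has_trace_sum => i; exact: h. Qed.

Lemma traced_ext f g : (forall y, Omega y -> f y = g y) -> traced f -> traced g.
Proof. by move=> fg hf x cx; apply: has_trace_ext fg _; exact: hf. Qed.

End trace_calculus.
Arguments traced_cst {R d} Omega c.

(** * Integrals over the domain *)

Section integration.
Context {R : realType} {d : nat} (Omega : set 'rV[R]_d).
Hypotheses (oO : open Omega) (bO : bounded_set Omega).
Implicit Types (f g : 'rV[R]_d -> R) (x : 'rV[R]_d).

Lemma compact_closure_bounded : compact (closure Omega).
Proof.
apply: bounded_closed_compact; last exact: closed_closure.
case: bO => M [Mr h]; exists M; split => // e Me x.
suff : closure Omega `<=` [set x | `|x| <= e] by apply.
have clB : closed [set x : 'rV[R]_d | `|x| <= e].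
  apply: (@closed_comp _ _ (fun x : 'rV[R]_d => `|x|) [set r | r <= e]).
    by move=> y _; exact: norm_continuous.
  exact: closed_le.
rewrite [X in _ `<=` X](closure_id _).1//.
by apply: closure_subset => y; exact: h.
Qed.

(** At an interior point the limit defining the trace sees the point itself,
    so it can only be the value there. *)
Lemma traced_continuous f x : traced Omega f -> Omega x -> {for x, continuous f}.
Proof.
move=> hf Ox.
have cx : closure Omega x by exact: subset_closure.
have wE : within Omega (nbhs x) = nbhs x.
  by apply: within_interior; rewrite (interior_id Omega).1.
have := hf x cx; rewrite /has_trace wE => /cvg_ex[/= l fl].
suff lE : l = f x by move: fl; rewrite lE.
apply/esym.
apply/eqP; rewrite -subr_eq0 -normr_eq0; apply/eqP/le_anti.
rewrite normr_ge0 andbT; apply/ler_addgt0Pl => e e0; rewrite addr0.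
have /nbhs_singleton : nbhs x [set y | `|l - f y| <= e].
  by move/cvgrPdist_le : fl; exact.
by rewrite /= distrC.
Qed.

(** Each point of the compact closure has a neighbourhood on which f stays
    within distance 1 of its trace; finitely many of them suffice. *)
Lemma traced_bounded f : traced Omega f ->
  exists M : R, forall x, Omega x -> `|f x| <= M.
Proof.
move=> hf.
have /compact_near_coveringP nc := compact_closure_bounded.
have : \forall M \near +oo%R, closure Omega `<=` [set x | Omega x -> `|f x| <= M].
  apply: (nc _ _ (fun M x => Omega x -> `|f x| <= M)) => x /hf/cvg_ex[/= l fl].
  have h1 : \forall y \near x, Omega y -> `|f y| <= `|l| + 1.
    have : \forall y \near x, Omega y -> `|l - f y| <= 1.
      by move/cvgrPdist_le : fl => /(_ 1 ltr01).
    apply: filterS => y h /h {}h.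
    by rewrite -[f y](subrK l) (le_trans (ler_normD _ _))// addrC lerD// distrC.
  have h2 : \forall M \near +oo%R, `|l| + 1 <= M.
    by apply: nbhs_pinfty_ge; rewrite num_real.
  exists ([set y | Omega y -> `|f y| <= `|l| + 1], [set M | `|l| + 1 <= M]) => //=.
  by move=> [y M] [/= a b] Oy; exact: le_trans (a Oy) b.
case/pinfty_ex_gt0 => M _ h; exists M => x Ox.
by apply: h => //; exact: subset_closure.
Qed.

Lemma Omega_measurable : measurable (Omega : set (borel_rV R d)).
Proof. exact: open_measurable_rV. Qed.

Lemma Omega_finite : (lebesgue_rV d Omega < +oo)%E.
Proof.
case: bO => M [Mr h]; pose N := `|M| + 1.
have N0 : 0 <= N by rewrite addr_ge0.
apply: (@le_lt_trans _ _ (lebesgue_rV d (box (const_mx (- N)) (const_mx N)))).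
  apply: le_measure; rewrite ?inE; [exact: Omega_measurable|exact: measurable_box|].
  move=> x /h hx i; rewrite !mxE -ler_norml.
  apply: (@le_trans _ _ `|x : 'rV[R]_d|); last first.
    by apply: hx; rewrite ltr_pwDr// ler_norm.
  rewrite [leRHS]/Num.norm/= mx_normrE.
  exact: (le_bigmax _ (fun ij => `|(x : 'rV[R]_d) ij.1 ij.2|) (0, i)).
rewrite lebesgue_rV_box ?ltry// => i; rewrite !mxE.
by rewrite (@le_trans _ _ 0)// oppr_le0.
Qed.

Lemma traced_measurable f : traced Omega f ->
  measurable_fun (Omega : set (borel_rV R d)) (f : borel_rV R d -> R).
Proof.
move=> hf; apply: (measurability _ (RGenOpens.measurableE R)).
move=> _ [_ [a [b ->]] <-]; 
suff : open (Omega `&` f @^-1` `]a, b[) by exact: open_measurable_rV.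
rewrite openE => x [Ox fx]; apply: filterI.
  by apply: open_nbhs_nbhs.
apply: (traced_continuous hf Ox).
by apply: open_nbhs_nbhs; split => //; exact: interval_open.
Qed.

Lemma traced_integrable f : traced Omega f ->
  (lebesgue_rV d).-integrable (Omega : set (borel_rV R d)) (EFin \o f).
Proof.
move=> hf; apply: measurable_bounded_integrable.
- exact: Omega_measurable.
- exact: Omega_finite.
- exact: traced_measurable.
- have [M h] := traced_bounded hf; exists M; split; first exact: num_real.
  by move=> N MN x Ox; exact: le_trans (h _ Ox) (ltW MN).
Qed.

Lemma vol_integralD f g : traced Omega f -> traced Omega g ->
  vol_integral Omega (fun x => f x + g x) = vol_integral Omega f + vol_integral Omega g.
Proof.
by move=> hf hg; apply: RintegralD; [exact: Omega_measurable| |]; exact: traced_integrable.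
Qed.

Lemma vol_integralB f g : traced Omega f -> traced Omega g ->
  vol_integral Omega (fun x => f x - g x) = vol_integral Omega f - vol_integral Omega g.
Proof.
by move=> hf hg; apply: RintegralB; [exact: Omega_measurable| |]; exact: traced_integrable.
Qed.

Lemma vol_integralZ (r : R) f : traced Omega f ->
  vol_integral Omega (fun x => r * f x) = r * vol_integral Omega f.
Proof.
by move=> hf; apply: RintegralZl; [exact: Omega_measurable|exact: traced_integrable].
Qed.

Lemma vol_integral_cst0 : vol_integral Omega (fun=> 0) = 0.
Proof. by rewrite [LHS](Rintegral_cst _ Omega_measurable) mul0r. Qed.

Lemma vol_integral_sum (I : finType) (F : I -> 'rV[R]_d -> R) :
  (forall i, traced Omega (F i)) ->
  vol_integral Omega (fun x => \sum_i F i x) = \sum_i vol_integral Omega (F i).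
Proof.
move=> tF.
suff E s : vol_integral Omega (fun x => \sum_(i <- s) F i x) =
    \sum_(i <- s) vol_integral Omega (F i) /\
    traced Omega (fun x => \sum_(i <- s) F i x) by case: (E (index_enum I)).
elim: s => [|i s [IH ts]].
  rewrite big_nil (_ : (fun x => _) = fun=> 0).
    by split; [exact: vol_integral_cst0|exact: traced_cst].
  by apply/funext => x; rewrite big_nil.
rewrite big_cons (_ : (fun x => _) = fun x => F i x + \sum_(j <- s) F j x).
  by split; [rewrite vol_integralD// IH|exact: tracedD].
by apply/funext => x; rewrite big_cons.
Qed.

Lemma eq_vol_integral f g : (forall x, Omega x -> f x = g x) ->
  vol_integral Omega f = vol_integral Omega g.
Proof. by move=> fg; apply: eq_Rintegral => x; rewrite inE; exact: fg. Qed.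

Lemma vol_integral_bound f (e : R) : traced Omega f ->
  (forall x, Omega x -> `|f x| <= e) ->
  `|vol_integral Omega f| <= e * fine (lebesgue_rV d Omega).
Proof.
move=> hf fe; have mO := Omega_measurable.
apply: le_trans (le_normr_Rintegral mO (traced_integrable hf)) _.
rewrite -Rintegral_cst//; apply: le_Rintegral => //.
  have /integrable_norm := traced_integrable hf.
  by [].
by apply: traced_integrable; exact: traced_cst.
Qed.

End integration.

(** * Fields of class C1 up to the boundary *)

Section directional_chain_rule.
Context {R : realType} {V : normedModType R}.
Implicit Types (f : V -> R) (x v : V) (k : R -> R).

Lemma derive_line f x v : 'D_v f x = 'D_1 (fun h : R => f (h *: v + x)) 0.
Proof.
pose q (h : R) := h^-1 *: ((f \o shift x) (h *: v) - f x).
pose g := fun h : R => f (h *: v + x).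
pose q' (h : R) := h^-1 *: ((g \o shift 0) (h *: 1) - g 0).
have qq' : q = q'.
  by apply/funext => h; rewrite /q /q' /g /= addr0 scale0r add0r [h *: 1]mulr1.
by rewrite /derive -/q -/g -/q' qq'.
Qed.

(** Only the directional derivative of f is assumed to exist, so the chain
    rule is applied to the restriction of f to the line through x. *)
Lemma is_derive_line_comp k f x v : derivable k (f x) 1 -> derivable f x v ->
  is_derive x v (k \o f) (derive1 k (f x) * 'D_v f x).
Proof.
move=> dk /derivable1P df.
have dk' : is_derive (f (0 *: v + x)) 1 k (derive1 k (f x)).
  by rewrite scale0r add0r derive1E; split.
have df' := derivableP df.
have [dkf Dkf] := is_derive1_comp dk' df'.
split; first exact/derivable1P.
by rewrite derive_line (derive_line f); exact: Dkf.
Qed.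

End directional_chain_rule.

Section partial_derivatives.
Context {R : realType} {d : nat}.
Implicit Types (f g : 'rV[R]_d -> R) (x : 'rV[R]_d) (i : 'I_d).
Local Notation e i := (delta_mx 0 i : 'rV[R]_d).

Lemma is_derive_pd i f x : derivable f x (e i) -> is_derive x (e i) f (pd i f x).
Proof. exact: derivableP. Qed.

Lemma pd_val i f x l : is_derive x (e i) f l -> pd i f x = l.
Proof. by move=> h; exact: derive_val. Qed.

Lemma is_pdD i f g x : derivable f x (e i) -> derivable g x (e i) ->
  is_derive x (e i) (fun y => f y + g y) (pd i f x + pd i g x).
Proof. by move=> /is_derive_pd df /is_derive_pd dg; exact: is_deriveD df dg. Qed.

Lemma is_pdM i f g x : derivable f x (e i) -> derivable g x (e i) ->
  is_derive x (e i) (fun y => f y * g y) (pd i f x * g x + f x * pd i g x).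
Proof.
move=> /is_derive_pd df /is_derive_pd dg.
by apply: is_derive_eq (is_deriveM df dg) _; rewrite addrC [g x *: _]mulrC.
Qed.

Lemma pd_cst i (c : R) x : pd i (fun=> c) x = 0.
Proof. exact: derive_cst. Qed.

Lemma is_pd_sum (I : finType) i (F : I -> 'rV[R]_d -> R) x :
  (forall j, derivable (F j) x (e i)) ->
  is_derive x (e i) (fun y => \sum_j F j y) (\sum_j pd i (F j) x).
Proof.
move=> h.
suff E s : is_derive x (e i) (fun y => \sum_(j <- s) F j y)
    (\sum_(j <- s) pd i (F j) x) by exact: E.
elim: s => [|j s IH].
  rewrite big_nil (_ : (fun y => _) = cst 0); first exact: is_derive_cst.
  by apply/funext => y; rewrite big_nil.
rewrite big_cons (_ : (fun y => _) = F j + fun y => \sum_(j <- s) F j y).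
  by apply: is_deriveD; exact: is_derive_pd.
by apply/funext => y; rewrite big_cons.
Qed.

End partial_derivatives.

Section C1_calculus.
Context {R : realType} {d : nat} (Omega : set 'rV[R]_d).
Implicit Types (f g : 'rV[R]_d -> R) (x : 'rV[R]_d) (i : 'I_d).
Local Notation C1 := (C1_closure Omega).

Lemma C1_derivable f i x : C1 f -> Omega x -> derivable f x (delta_mx 0 i).
Proof. by move=> [_ /(_ i)[h _]]; exact: h. Qed.

Lemma C1_traced f : C1 f -> traced Omega f.
Proof. by case. Qed.

Lemma C1_traced_pd f i : C1 f -> traced Omega (pd i f).
Proof. by move=> [_ /(_ i)[]]. Qed.

(** Existence of boundary values for the partial derivatives can be checked on
    formulas that agree with them inside Omega. *)
Lemma C1_intro f (df : 'I_d -> 'rV[R]_d -> R) : traced Omega f ->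
  (forall i, traced Omega (df i)) ->
  (forall i x, Omega x -> is_derive x (delta_mx 0 i : 'rV[R]_d) f (df i x)) ->
  C1 f.
Proof.
move=> tf tdf h; split; first exact: tf.
move=> i; split; first by move=> x /(h i)[].
by apply: traced_ext (tdf i) => x /(h i)[_].
Qed.

Lemma C1_cst (c : R) : C1 (fun=> c).
Proof.
by apply: (@C1_intro _ (fun _ _ => 0)) => [|i]; exact: traced_cst.
Qed.

Lemma C1D f g : C1 f -> C1 g -> C1 (fun y => f y + g y).
Proof.
move=> hf hg; apply: (@C1_intro _ (fun i x => pd i f x + pd i g x)).
- by apply: tracedD; exact: C1_traced.
- by move=> i; apply: tracedD; exact: C1_traced_pd.
- by move=> i x Ox; apply: is_pdD; exact: C1_derivable.
Qed.

Lemma C1M f g : C1 f -> C1 g -> C1 (fun y => f y * g y).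
Proof.
move=> hf hg; apply: (@C1_intro _ (fun i x => pd i f x * g x + f x * pd i g x)).
- by apply: tracedM; exact: C1_traced.
- move=> i; have [tf tg] := (C1_traced hf, C1_traced hg).
  by have [tf' tg'] := (C1_traced_pd (i := i) hf, C1_traced_pd (i := i) hg);
     apply: tracedD; exact: tracedM.
- by move=> i x Ox; apply: is_pdM; exact: C1_derivable.
Qed.

Lemma C1Z (c : R) f : C1 f -> C1 (fun y => c * f y).
Proof. by apply: C1M; exact: C1_cst. Qed.

Lemma C1B f g : C1 f -> C1 g -> C1 (fun y => f y - g y).
Proof.
move=> hf /(C1Z (-1)) hg; have := C1D hf hg.
by congr C1_closure; apply/funext => y; rewrite mulN1r.
Qed.

Lemma C1_sum (I : finType) (F : I -> 'rV[R]_d -> R) :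
  (forall j, C1 (F j)) -> C1 (fun y => \sum_j F j y).
Proof.
move=> h; apply: (@C1_intro _ (fun i x => \sum_j pd i (F j) x)).
- by apply: traced_sum => j; exact: C1_traced.
- by move=> i; apply: traced_sum => j; exact: C1_traced_pd.
- by move=> i x Ox; apply: is_pd_sum => j; exact: C1_derivable.
Qed.

Lemma C1_comp (k : R -> R) f : (forall s, derivable k s 1) ->
  continuous (derive1 k) -> C1 f -> C1 (k \o f).
Proof.
move=> dk ck' hf.
have ck : continuous k.
  by move=> s; apply: differentiable_continuous; apply/derivable1_diffP.
apply: (@C1_intro _ (fun i x => derive1 k (f x) * pd i f x)).
- by move=> x cx; apply: has_trace_comp => //; exact: C1_traced hf x cx.
- move=> i; apply: tracedM; last exact: (C1_traced_pd hf).
  by move=> x cx; apply: (has_trace_comp ck'); exact: C1_traced hf x cx.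
- by move=> i x Ox; apply: is_derive_line_comp => //; exact: C1_derivable.
Qed.

End C1_calculus.

(** * Green's formula without boundary flux *)

Section green.
Context {R : realType} {d : nat} (Omega : set 'rV[R]_d).
Hypothesis d_gt1 : (1 < d)%N.

(** The dimension d - 1 is positive here: in dimension 0 every set of a cover
    contributes one, since 0 ^+ 0 = 1. *)
Lemma hausdorff_set0 : hausdorff d.-1 (set0 : set (borel_rV R d)) = 0%E.
Proof.
have d1 : (0 < d.-1)%N by rewrite -subn1 subn_gt0.
have diam_ge0 (A : set 'rV[R]_d) : 0 <= diam A.
  rewrite /diam; set E := [set r | _].
  have [hE|/sup_out -> //] := pselect (has_sup E).
  have [r Er] := hE.1; apply: (@le_trans _ _ r).
    by case: Er => x [y [_ _ ->]]; exact: sqrtr_ge0.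
  exact: (sup_upper_bound hE).
have pre0 delta : hausdorff_pre d.-1 delta (set0 : set 'rV[R]_d) = 0%E.
  apply/eqP; rewrite eq_le; apply/andP; split.
    apply: ereal_inf_lbound; exists (fun=> set0); first by split.
    apply: eseries0 => k _ _.
    have -> : diam (set0 : set 'rV[R]_d) = 0.
      rewrite /diam (_ : [set r | _] = set0) ?sup0//.
      by apply/seteqP; split => // r [x [y []]].
    by rewrite mul0r expr0n eqn0Ngt d1 mulr0.
  apply: le_ereal_inf_tmp => _ [F _ <-]; apply: nneseries_ge0 => k _ _.
  rewrite lee_fin mulr_ge0 ?exprn_ge0 ?divr_ge0//.
  by rewrite fine_ge0// measure_ge0.
rewrite /hausdorff (_ : [set _ | _ in _] = [set 0%E]) ?ereal_sup1//.
apply/seteqP; split => [_ [delta _ <-]|_ ->]; first exact: pre0.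
by exists 1 => //=; exact: pre0.
Qed.

Import HBNNSimple.

(** This does not rest on additivity of the Hausdorff set function, only on its
    value at the empty set: the only nonnegative simple function
    below 0 has empty level sets at all nonzero values. *)
Lemma surface_integral0 (f : 'rV[R]_d -> R) :
  (forall x, boundary Omega x -> f x = 0) -> surface_integral Omega f = 0.
Proof.
move=> f0; rewrite /surface_integral /integral.
have -> : (fun x => (f x)%:E) \_ (boundary Omega) = cst 0%E.
  apply/funext => x; rewrite patchE; case: ifPn => //; rewrite inE => /f0 ->.
  by [].
have -> : (cst 0%E : borel_rV R d -> \bar R)^\+%E = cst 0%E.
  by apply/funext => x; rewrite funeposE maxxx.
have -> : (cst 0%E : borel_rV R d -> \bar R)^\-%E = cst 0%E.
  by apply/funext => x; rewrite funenegE oppe0 maxxx.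
set S := [set _ | _ in _].
suff -> : S = [set 0%E] by rewrite ereal_sup1 sube0.
have sint0 : sintegral (@hausdorff R d d.-1) (cst 0) = 0%E.
  rewrite /sintegral fsbig1// => r _; have [->|r0] := eqVneq r 0.
    by rewrite mul0e.
  rewrite preimage_cst ifF ?hausdorff_set0 ?mule0//.
  by apply/negbTE; rewrite notin_setE/= => /esym/eqP; apply/negP.
apply/seteqP; split => [_ [h /= h0 <-]|_ ->].
  rewrite -[RHS]sint0; congr sintegral; apply/funext => x.
  apply/le_anti/andP; split; first by rewrite -lee_fin; exact: h0.
  exact: fun_ge0.
by exists nnsfun0 => //=; exact: sint0.
Qed.

Lemma green_zero (F : 'rV[R]_d -> 'rV[R]_d) : green_formula Omega ->
  (forall i, C1_closure Omega (fun x => F x 0 i)) ->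
  (forall x, boundary Omega x ->
    \sum_i trace Omega (fun y => F y 0 i) x * normal Omega x 0 i = 0) ->
  vol_integral Omega (div F) = 0.
Proof. by move=> green C1F F0; rewrite green// surface_integral0. Qed.

End green.

(** * One-sided time derivatives *)

Section one_sided_MVT.
Context {R : realType} (T : R).
Implicit Types (g : R -> R) (a b c s t : R).

Lemma near_time (t : R) (P : R -> Prop) :
  (forall s, 0 <= s <= T -> s != t -> P s) -> \forall s \near within `[0, T] t^', P s.
Proof.
move=> h; apply/nbhs_ballP; exists 1 => //= s _ st sT.
by apply: h => //; move: sT; rewrite /= in_itv.
Qed.

Lemma nbhs_within {U : topologicalType} (D A : set U) (x : U) :
  nbhs x A -> within D (nbhs x) A.
Proof. by apply: filterS => y Ay _. Qed.

Lemma nbhs_time (t : R) (A : set R) : nbhs t A -> within `[0, T] t^' A.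
Proof. by apply: filterS => s As _ _. Qed.

(** Since T > 0, every time in [0, T] is a limit of other admissible times;
    this gives uniqueness of the derivative, at the end points too. *)
Lemma time_filter_proper (t : R) : 0 < T -> 0 <= t <= T ->
  ProperFilter (within `[0, T] t^').
Proof.
move=> T0 /andP[t0 tT]; split; last exact: within_filter.
move=> /nbhs_ballP[e /= e0 h].
(* a step of at most T / 2 stays in [0, T] in one of the two directions *)
pose r := Num.min (e / 2) (T / 2).
have r0 : 0 < r by rewrite lt_min !divr_gt0.
have re : r < e by rewrite gt_min ltr_pdivrMr// ltr_pMr// ltr1n.
have rT : r <= T / 2 by rewrite ge_min lexx orbT.
have [tT2|tT2] := leP t (T / 2).
  apply: (h (t + r)); rewrite /= ?in_itv/=.
  - by rewrite /ball/= opprD addNKr normrN gtr0_norm.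
  - by rewrite -subr_eq0 addrAC subrr add0r gt_eqF.
  - by apply/andP; split; lra.
apply: (h (t - r)); rewrite /= ?in_itv/=.
- by rewrite /ball/= opprB addrCA subrr addr0 gtr0_norm.
- by rewrite -subr_eq0 addrAC subrr add0r oppr_eq0 gt_eqF.
- by apply/andP; split; lra.
Qed.

Lemma tderivable_continuous g t : tderivable T g t ->
  g s @[s --> within `[0, T] (nbhs t)] --> g t.
Proof.
move=> /cvg_ex[/= L gL]; apply/cvgrPdist_le => e e0.
have near1 : \forall s \near t, s != t -> `[0, T]%classic s ->
    `|L - time_quotient g t s| <= 1.
  by move/cvgrPdist_le : gL => /(_ 1 ltr01).
have L1 : 0 < `|L| + 1 by rewrite ltr_wpDl.
have near2 : \forall s \near t, `|t - s| < e / (`|L| + 1).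
  by apply: (nbhsx_ballx t (e / (`|L| + 1))); rewrite divr_gt0.
apply: filterS2 near1 near2 => s h1 h2 sT.
have [->|st] := eqVneq s t; first by rewrite subrr normr0 ltW.
have qL : `|time_quotient g t s| <= `|L| + 1.
  rewrite -[time_quotient _ _ _](subrK L) (le_trans (ler_normD _ _))// addrC lerD//.
  by rewrite distrC h1.
have -> : g t - g s = time_quotient g t s * (t - s).
  by rewrite /time_quotient -[t - s]opprB mulrN divfK ?subr_eq0// opprB.
by rewrite normrM (le_trans (ler_pM _ _ qL (ltW h2)))// mulrCA divff ?mulr1// gt_eqF.
Qed.

Lemma tderivable_interior g t : 0 < t < T -> tderivable T g t ->
  is_derive t 1 g (tderive T g t).
Proof.
move=> tT gt.
suff gD : h^-1 *: ((g \o shift t) (h *: 1) - g t) @[h --> (0 : R)^'] --> tderive T g t.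
  by split; [exact: (cvgP _ gD)|exact: cvg_lim gD].
apply/cvgrPdist_le => e e0.
have near1 : \forall s \near t, s != t -> `[0, T]%classic s ->
    `|tderive T g t - time_quotient g t s| <= e.
  by move/cvgrPdist_le : gt => /(_ e e0).
have near2 : \forall s \near t, `[0, T]%classic s.
  apply: filterS (near_in_itvoo _ : \forall s \near t, s \in `]0, T[) => [s|].
    exact: subset_itvW.
  by rewrite in_itv.
have sh : h + t @[h --> (0 : R)] --> t.
  by rewrite -{2}[t]add0r; apply: cvgD; [exact: cvg_id|exact: cvg_cst].
have near3 : \forall h \near (0 : R), (h + t != t -> `[0, T]%classic (h + t) ->
    `|tderive T g t - time_quotient g t (h + t)| <= e) /\ `[0, T]%classic (h + t).
  exact: sh _ (filterI near1 near2).
apply: filterS near3 => h /= [h1 h2] h0.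
have := h1; rewrite /time_quotient addrK mulrC [h *: 1]mulr1; apply => //.
by rewrite -subr_eq0 addrK.
Qed.

Lemma tderivable_MVT g a b : (forall t, 0 <= t <= T -> tderivable T g t) ->
  0 <= a -> a < b -> b <= T ->
  exists2 c, a < c < b & g b - g a = tderive T g c * (b - a).
Proof.
move=> dg a0 ab bT.
have [c]: exists2 c, c \in `]a, b[ & g b - g a = tderive T g c * (b - a).
  apply: MVT => // [x|].
    rewrite in_itv/= => /andP[ax xb]; apply: tderivable_interior.
      by apply/andP; split; lra.
    by apply: dg; apply/andP; split; lra.
  apply/subspace_continuousP => x /=; rewrite in_itv/= => /andP[ax xb].
  have xT : 0 <= x <= T by apply/andP; split; lra.
  apply: cvg_trans (tderivable_continuous (dg x xT)).
  apply: cvg_app; apply: within_subset => s /=; rewrite !in_itv/= => /andP[? ?].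
  by apply/andP; split; lra.
by rewrite in_itv/= => cab gE; exists c.
Qed.

(** The form of the mean value theorem used below: a difference quotient at t
    is a value of the derivative at a time at least as close to t. *)
Lemma time_quotient_MVT g s t : (forall t, 0 <= t <= T -> tderivable T g t) ->
  0 <= s <= T -> 0 <= t <= T -> s != t ->
  exists c, [/\ 0 <= c <= T, `|t - c| <= `|t - s| & time_quotient g t s = tderive T g c].
Proof.
move=> dg /andP[s0 sT] /andP[t0 tT] st.
have [lt|lt|E] := ltgtP s t; last by rewrite E eqxx in st.
  have [c /andP[sc ct] gE] := tderivable_MVT dg s0 lt tT.
  exists c; split; first by apply/andP; split; lra.
    by rewrite !gtr0_norm ?subr_gt0//; lra.
  by rewrite /time_quotient -[g s - _]opprB gE -mulrN opprB mulfK// subr_eq0.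
have [c /andP[tc cs] gE] := tderivable_MVT dg t0 lt sT.
exists c; split; first by apply/andP; split; lra.
  by rewrite !ltr0_norm ?subr_lt0//; lra.
by rewrite /time_quotient gE mulfK// subr_eq0.
Qed.

End one_sided_MVT.

(** * Differentiating space integrals in time *)

Section time_calculus.
Context {R : realType} {d : nat} (Omega : set 'rV[R]_d) (T t : R).
Implicit Types (f g q : R -> 'rV[R]_d -> R) (l m df dg : 'rV[R]_d -> R) (x : 'rV[R]_d).

(** Convergence of q s to l as s tends to t, in the form of a joint limit in
    (s, y) at every point of the closure of Omega. By compactness it amounts
    to uniform convergence, but it is stable under products by the usual
    rules for limits, with no bound to carry along. *)
Definition jointly q l := traced Omega l /\ forall x, closure Omega x ->
  q p.1 p.2 @[p --> filter_prod (within `[0, T] t^') (within Omega (nbhs x))]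
    --> trace Omega l x.

Lemma jointly_cst l : traced Omega l -> jointly (fun=> l) l.
Proof.
move=> tl; split => // x cx.
apply: (@cvg_comp _ _ _ snd l _ (within Omega (nbhs x))); last exact: tl.
exact: cvg_snd.
Qed.

Lemma jointlyD q r l m : jointly q l -> jointly r m ->
  jointly (fun s x => q s x + r s x) (fun x => l x + m x).
Proof.
move=> [tl ql] [tm rm]; split=> [|x cx]; first exact: tracedD.
rewrite traceD//; [|exact: tl|exact: tm].
by apply: cvgD; [exact: ql|exact: rm].
Qed.

Lemma jointlyM q r l m : jointly q l -> jointly r m ->
  jointly (fun s x => q s x * r s x) (fun x => l x * m x).
Proof.
move=> [tl ql] [tm rm]; split=> [|x cx]; first exact: tracedM.
rewrite traceM//; [|exact: tl|exact: tm].
by apply: cvgM; [exact: ql|exact: rm].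
Qed.

Lemma jointly_sum (I : finType) (q : I -> R -> 'rV[R]_d -> R) (l : I -> 'rV[R]_d -> R) :
  (forall i, jointly (q i) (l i)) ->
  jointly (fun s x => \sum_i q i s x) (fun x => \sum_i l i x).
Proof.
move=> h; split=> [|x cx]; first by apply: traced_sum => i; case: (h i).
rewrite trace_sum// => [|i]; last by case: (h i) => + _; exact.
by apply: cvg_sumr => i; case: (h i) => _; exact.
Qed.

Lemma jointly_ext q r l m :
  (forall s x, 0 <= s <= T -> s != t -> Omega x -> q s x = r s x) ->
  (forall x, Omega x -> l x = m x) -> jointly q l -> jointly r m.
Proof.
move=> qr lm [tl ql]; split=> [|x cx]; first exact: traced_ext tl.
have -> : trace Omega m x = trace Omega l x.
  apply: trace_unique => //; apply: cvg_trans (tl x cx).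
  by apply: near_eq_cvg; apply: near_within_Omega => y /lm.
apply: cvg_trans (ql x cx); apply: near_eq_cvg.
exists ([set s | 0 <= s <= T /\ s != t], Omega) => /=.
  split; first by apply: near_time => s ? ?; split.
  exact: withinT.
by move=> [s y] /= [[sT st] Oy]; exact: qr.
Qed.

Lemma slice_cvg f x (L : R) : 0 <= t <= T ->
  f p.1 p.2 @[p --> within (`[0, T] `*` Omega) (nbhs (t, x))] --> L ->
  f t y @[y --> within Omega (nbhs x)] --> L.
Proof.
move=> tT; apply: (@cvg_comp _ _ _ (fun y => (t, y)) (fun p => f p.1 p.2)).
move=> P [[A B] /= [tA xB] AB]; apply: filterS xB => y By Oy.
apply: (AB (t, y)) => /=; last by split => //; rewrite in_itv.
by split => //; exact: nbhs_singleton.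
Qed.

Lemma extends_at f x : 0 <= t <= T -> extends_continuously Omega T f ->
  closure Omega x -> has_trace Omega (f t) x /\
  f p.1 p.2 @[p --> within (`[0, T] `*` Omega) (nbhs (t, x))] --> trace Omega (f t) x.
Proof.
move=> tT hf cx; have /cvg_ex[/= L fL] := hf t x tT cx.
have h := slice_cvg tT fL; rewrite (trace_unique cx h); split => //.
by apply/cvg_ex; exists L.
Qed.

Lemma jointly_extends f : 0 <= t <= T -> extends_continuously Omega T f -> jointly f (f t).
Proof.
move=> tT hf; split=> x cx; have [h1 h2] := extends_at tT hf cx; first exact: h1.
apply: cvg_trans h2; apply: cvg_app => P [[A B] /= [tA xB] AB].
exists ([set s | 0 <= s <= T] `&` A, Omega `&` B) => /=.
  split; apply: filterI; [exact: near_time| |exact: withinT|exact: nbhs_within].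
  exact: nbhs_time.
by move=> [s y] /= [[sT As] [Oy By]]; exact: (AB (s, y)).
Qed.

Section integral_limit.
Hypotheses (oO : open Omega) (bO : bounded_set Omega).

(** Near each point x of the closure both q s and l are close to the trace of l
    at x, hence to each other; compactness makes the time interval uniform in
    x, and Omega has finite volume. *)
Lemma vol_integral_cvg q l : jointly q l ->
  (forall s, 0 <= s <= T -> s != t -> traced Omega (q s)) ->
  vol_integral Omega (q s) @[s --> within `[0, T] t^'] --> vol_integral Omega l.
Proof.
move=> [tl ql] tq; apply/cvgrPdist_le => e e0.
pose M := fine (lebesgue_rV d Omega) + 1.
have V0 : 0 <= fine (lebesgue_rV d Omega) by rewrite fine_ge0// measure_ge0.
have M0 : 0 < M by rewrite ltr_wpDl.
pose e' := e / M.
have e'0 : 0 < e' by rewrite divr_gt0.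
have /compact_near_coveringP nc := compact_closure_bounded bO.
have close : \forall s \near within `[0, T] t^',
    closure Omega `<=` [set x | Omega x -> `|l x - q s x| <= e'].
  apply: (nc _ _ (fun s x => Omega x -> `|l x - q s x| <= e')) => x cx.
  have e20 : 0 < e' / 2 by rewrite divr_gt0.
  have [[A B] /= [tA xB] AB] : filter_prod (within `[0, T] t^') (within Omega (nbhs x))
      [set p | `|trace Omega l x - q p.1 p.2| <= e' / 2].
    by move/cvgrPdist_le : (ql x cx) => /(_ _ e20).
  have xC : \forall y \near x, Omega y -> `|trace Omega l x - l y| <= e' / 2.
    by move/cvgrPdist_le : (tl x cx) => /(_ _ e20).
  exists ([set y | (Omega y -> B y) /\ (Omega y -> `|trace Omega l x - l y| <= e' / 2)], A).
    by split => //; exact: filterI.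
  move=> [y s] /= [[By Cy] As] Oy.
  rewrite (splitr e') -[l y](subrK (trace Omega l x)) -addrA.
  rewrite (le_trans (ler_normD _ _))// lerD//; first by rewrite distrC Cy.
  by apply: (AB (s, y)); split => //=; exact: By.
have adm : \forall s \near within `[0, T] t^', 0 <= s <= T /\ s != t.
  by apply: near_time.
apply: filterS2 close adm => s hs [sT st]; have tqs := tq s sT st.
rewrite -vol_integralB//.
apply: le_trans (vol_integral_bound oO bO _ (e := e') _) _.
- exact: tracedB.
- by move=> x Ox; apply: hs => //; exact: subset_closure.
- rewrite /e' mulrAC ler_pdivrMr// ler_pM2l//.
  by rewrite /M lerDl.
Qed.

End integral_limit.

(** Differentiability at time t in the sense needed under a space integral.
    The convergence of f s itself is part of the notion because the product
    rule for difference quotients uses it. *)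
Definition tdiff f (df : 'rV[R]_d -> R) :=
  [/\ forall s, 0 <= s <= T -> traced Omega (f s),
      jointly f (f t) &
      jointly (fun s x => time_quotient (f ^~ x) t s) df].

Lemma traced_quotient f s : traced Omega (f s) -> traced Omega (f t) ->
  traced Omega (fun x => time_quotient (f ^~ x) t s).
Proof. move=> fs ft; exact (tracedM (tracedB fs ft) (traced_cst Omega (s - t)^-1)). Qed.

Lemma tdiff_cst l : traced Omega l -> tdiff (fun=> l) (fun=> 0).
Proof.
move=> tl; split=> //; first exact: jointly_cst.
apply: (@jointly_ext (fun _ _ => 0) _ (fun=> 0)) => //.
  by move=> s x _ _ _; rewrite /time_quotient subrr mul0r.
by apply: jointly_cst; exact: traced_cst.
Qed.

Lemma tdiffD f g df dg : tdiff f df -> tdiff g dg ->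
  tdiff (fun s x => f s x + g s x) (fun x => df x + dg x).
Proof.
move=> [tf jf qf] [tg jg qg]; split.
- by move=> s sT; apply: tracedD; [exact: tf|exact: tg].
- exact: jointlyD.
- apply: jointly_ext (jointlyD qf qg) => // s x _ _ _.
  by rewrite /time_quotient; set k := (s - t)^-1; ring.
Qed.

Lemma tdiffM f g df dg : 0 <= t <= T -> tdiff f df -> tdiff g dg ->
  tdiff (fun s x => f s x * g s x) (fun x => df x * g t x + f t x * dg x).
Proof.
move=> tT [tf jf qf] [tg jg qg]; split.
- by move=> s sT; apply: tracedM; [exact: tf|exact: tg].
- exact: jointlyM.
- have jft := jointly_cst (tf t tT).
  apply: jointly_ext (jointlyD (jointlyM qf jg) (jointlyM jft qg)) => // s x _ _ _.
  by rewrite /time_quotient; set k := (s - t)^-1; ring.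
Qed.

Lemma tdiff_sum (I : finType) (f : I -> R -> 'rV[R]_d -> R) (df : I -> 'rV[R]_d -> R) :
  (forall i, tdiff (f i) (df i)) ->
  tdiff (fun s x => \sum_i f i s x) (fun x => \sum_i df i x).
Proof.
move=> h; split.
- by move=> s sT; apply: traced_sum => i; case: (h i) => + _ _; exact.
- by apply: jointly_sum => i; case: (h i).
- apply: (@jointly_ext (fun s x => \sum_i time_quotient ((f i) ^~ x) t s) _
    (fun x => \sum_i df i x)) => //.
    by move=> s x _ _ _; rewrite /time_quotient -sumrB -mulr_suml.
  by apply: jointly_sum => i; case: (h i).
Qed.

Lemma tdiff_ext f g df dg : 0 <= t <= T ->
  (forall s x, 0 <= s <= T -> Omega x -> f s x = g s x) ->
  (forall x, Omega x -> df x = dg x) -> tdiff f df -> tdiff g dg.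
Proof.
move=> tT fg dfg [tf jf qf]; split.
- by move=> s sT; apply: traced_ext (tf s sT) => x; exact: fg.
- by apply: jointly_ext jf => *; exact: fg.
- apply: jointly_ext qf => // s x sT _ Ox.
  by rewrite /time_quotient !fg.
Qed.

Lemma tdiffZ f df c : 0 <= t <= T -> tdiff f df ->
  tdiff (fun s x => c * f s x) (fun x => c * df x).
Proof.
move=> tT tf; apply: tdiff_ext tT _ _ (tdiffM tT (tdiff_cst (traced_cst Omega c)) tf) => //.
by move=> x _; rewrite mul0r add0r.
Qed.

Lemma tdiff_integral f df : open Omega -> bounded_set Omega -> 0 <= t <= T ->
  tdiff f df ->
  has_tderive T (fun s => vol_integral Omega (f s)) t (vol_integral Omega df).
Proof.
move=> oO bO tT [tf jf qf].
have tq s : 0 <= s <= T -> s != t -> traced Omega (fun x => time_quotient (f ^~ x) t s).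
  by move=> sT _; exact: traced_quotient (tf s sT) (tf t tT).
apply: cvg_trans (vol_integral_cvg oO bO qf tq); apply: near_eq_cvg.
apply: near_time => s sT st; rewrite {2}/time_quotient -vol_integralB//; [|exact: tf|exact: tf].
rewrite mulrC -vol_integralZ//; last by apply: tracedB; exact: tf.
by apply: eq_vol_integral => x _; rewrite mulrC.
Qed.

End time_calculus.

Section tdiff_smooth.
Context {R : realType} {d : nat} (Omega : set 'rV[R]_d) (T : R).
Implicit Types (f : R -> 'rV[R]_d -> R) (t : R).

Lemma extends_traced f t : extends_continuously Omega T f -> 0 <= t <= T ->
  traced Omega (f t).
Proof. by move=> hf tT; case: (jointly_extends tT hf). Qed.

(** By the mean value theorem the quotient at (s, y) is the time derivative at
    (c, y) for some c between s and t, so joint convergence of the quotient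
    follows from that of the time derivative. *)
Lemma tdiff_of_dt f t : 0 <= t <= T -> extends_continuously Omega T f ->
  (forall s x, 0 <= s <= T -> Omega x -> tderivable T (f ^~ x) s) ->
  extends_continuously Omega T (dt T f) -> tdiff Omega T t f (dt T f t).
Proof.
move=> tT hf df hdf; split.
- by move=> s; exact: extends_traced.
- exact: jointly_extends.
- split=> [|x cx]; first exact: extends_traced.
apply/cvgrPdist_le => e e0.
have [_ fL] := extends_at tT hdf cx.
have [[A B] /= [/nbhs_ballP[r /= r0 rA] xB] AB] : nbhs (t, x)
    [set p : R * 'rV[R]_d | (`[0, T] `*` Omega) p ->
      `|trace Omega (dt T f t) x - dt T f p.1 p.2| <= e].
  by move/cvgrPdist_le : fL => /(_ e e0).
exists ([set s | [/\ 0 <= s <= T, s != t & ball t r s]], Omega `&` B) => /=.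
  split; last by apply: filterI; [exact: withinT|exact: nbhs_within].
  apply: filterS2 (near_time (fun s sT st => conj sT st))
    (nbhs_time T (nbhsx_ballx t r r0)) => s [? ?] ?; by split.
move=> [s y] /= [[sT st tr_s] [Oy By]].
have dfy s' : 0 <= s' <= T -> tderivable T (f ^~ y) s' by move=> ?; exact: df.
have [c [cT tc ->]] := time_quotient_MVT dfy sT tT st.
apply: (AB (c, y)) => /=.
  by split => //; apply: rA; rewrite /ball/=; exact: le_lt_trans tc tr_s.
by split => //; rewrite in_itv.
Qed.

End tdiff_smooth.

Section has_tderive_calculus.
Context {R : realType} (T t : R).
Implicit Types (f g : R -> R).

Lemma has_tderive_ext f g l : 0 <= t <= T ->
  (forall s, 0 <= s <= T -> f s = g s) -> has_tderive T f t l -> has_tderive T g t l.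
Proof.
move=> tT fg; apply: cvg_trans; apply: near_eq_cvg.
by apply: near_time => s sT _; rewrite /time_quotient !fg.
Qed.

Lemma has_tderiveD f g l m : has_tderive T f t l -> has_tderive T g t m ->
  has_tderive T (fun s => f s + g s) t (l + m).
Proof.
move=> hf hg.
have : (time_quotient f t s + time_quotient g t s) @[s --> within `[0, T] t^'] --> l + m.
  exact: cvgD.
apply: cvg_trans; apply: near_eq_cvg.
by apply: near_time => s _ _; rewrite /time_quotient; set k := (s - t)^-1; ring.
Qed.

Lemma has_tderiveZ c f l : has_tderive T f t l ->
  has_tderive T (fun s => c * f s) t (c * l).
Proof.
move=> hf.
have : (c * time_quotient f t s) @[s --> within `[0, T] t^'] --> c * l.
  by apply: cvgM => //; exact: cvg_cst.
apply: cvg_trans; apply: near_eq_cvg.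
by apply: near_time => s _ _; rewrite /time_quotient; set k := (s - t)^-1; ring.
Qed.

Lemma has_tderive_unique f l m : 0 < T -> 0 <= t <= T ->
  has_tderive T f t l -> has_tderive T f t m -> l = m.
Proof.
move=> T0 tT; have := time_filter_proper T0 tT => ?; exact: cvg_unique.
Qed.

Lemma has_tderive_cst c : has_tderive T (fun=> c) t 0.
Proof.
have : 0 @[s --> within `[0, T] t^'] --> (0 : R) by exact: cvg_cst.
apply: cvg_trans; apply: near_eq_cvg.
by apply: near_time => s _ _; rewrite /time_quotient subrr mul0r.
Qed.

Lemma tderive_sum (I : finType) (f : I -> R -> R) : 0 < T -> 0 <= t <= T ->
  (forall i, tderivable T (f i) t) ->
  tderive T (fun s => \sum_i f i s) t = \sum_i tderive T (f i) t.
Proof.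
move=> T0 tT df; have := time_filter_proper T0 tT => ?.
apply: cvg_lim => //.
have : (\sum_i time_quotient (f i) t s) @[s --> within `[0, T] t^'] -->
    \sum_i tderive T (f i) t by apply: cvg_sumr => i; exact: df.
apply: cvg_trans; apply: near_eq_cvg; apply: near_time => s _ _.
by rewrite /time_quotient -sumrB -mulr_suml.
Qed.

End has_tderive_calculus.

(** * Fields continuous in space-time *)

Section extends_calculus.
Context {R : realType} {d : nat} (Omega : set 'rV[R]_d) (T : R).
Implicit Types (f g : R -> 'rV[R]_d -> R) (x : 'rV[R]_d).
Local Notation ext := (extends_continuously Omega T).

Lemma ext_cst (c : R) : ext (fun _ _ => c).
Proof. by move=> t x _ _; apply/cvg_ex; exists c; exact: cvg_cst. Qed.

Lemma extD f g : ext f -> ext g -> ext (fun s x => f s x + g s x).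
Proof. by move=> hf hg t x tT cx; apply: is_cvgD; [exact: hf|exact: hg]. Qed.

Lemma extM f g : ext f -> ext g -> ext (fun s x => f s x * g s x).
Proof. by move=> hf hg t x tT cx; apply: is_cvgM; [exact: hf|exact: hg]. Qed.

Lemma extB f g : ext f -> ext g -> ext (fun s x => f s x - g s x).
Proof. by move=> hf hg t x tT cx; apply: is_cvgB; [exact: hf|exact: hg]. Qed.

Lemma ext_sum (I : finType) (f : I -> R -> 'rV[R]_d -> R) :
  (forall i, ext (f i)) -> ext (fun s x => \sum_i f i s x).
Proof.
move=> h t x tT cx; apply/cvg_ex.
exists (\sum_i lim (f i p.1 p.2 @[p --> within (`[0, T] `*` Omega) (nbhs (t, x))])).
by apply: cvg_sumr => i; exact: h.
Qed.

Lemma ext_comp (k : R -> R) f : continuous k -> ext f -> ext (fun s x => k (f s x)).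
Proof.
move=> ck hf t x tT cx; have /cvg_ex[/= L fL] := hf t x tT cx.
by apply/cvg_ex; exists (k L); apply: continuous_cvg fL; exact: ck.
Qed.

(** Extends to time t an equation that is known at all other times; it
    is what gives the heat equation at t = 0. *)
Lemma ext_eq0 f t x : open Omega -> 0 < T -> 0 <= t <= T -> Omega x -> ext f ->
  (forall s, 0 <= s <= T -> s != t -> f s x = 0) -> f t x = 0.
Proof.
move=> oO T0 tT Ox hf f0.
have cx : closure Omega x by exact: subset_closure.
have [_ ft] := extends_at tT hf cx.
have trE : trace Omega (f t) x = f t x.
  have ctf := traced_continuous oO (extends_traced hf tT) Ox.
  apply: trace_unique => //; apply: cvg_trans ctf; apply: cvg_app.
  exact: cvg_within.
have := time_filter_proper T0 tT => ?.
have h1 : f s x @[s --> within `[0, T] t^'] --> f t x.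
  rewrite -trE.
  apply: (@cvg_comp _ _ _ (fun s => (s, x)) (fun p => f p.1 p.2)); last exact: ft.
  move=> P [[A B] /= [tA xB] AB]; apply: filterS tA => s As st sT.
  by apply: (AB (s, x)) => //=; split => //; exact: nbhs_singleton.
have h2 : f s x @[s --> within `[0, T] t^'] --> (0 : R).
  have : 0 @[s --> within `[0, T] t^'] --> (0 : R) by exact: cvg_cst.
  apply: cvg_trans; apply: near_eq_cvg.
  by apply: near_time => s sT st; rewrite f0.
exact: cvg_unique h1 h2.
Qed.

End extends_calculus.
Arguments ext_cst {R d} Omega T c.

Section smooth_fields.
Context {R : realType} {d : nat} (Omega : set 'rV[R]_d) (T : R).
Implicit Types (f g : R -> 'rV[R]_d -> R) (x : 'rV[R]_d) (t : R).
Local Notation ext := (extends_continuously Omega T).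

Lemma C21_limit f t x : smooth_C21 Omega T f -> 0 <= t <= T -> closure Omega x ->
  f p.1 p.2 @[p --> within (`[0, T] `*` Omega) (nbhs (t, x))] --> f t x.
Proof.
move=> [+ _ _ _ _ _ _] tT cx => /subspace_continuousP/(_ (t, x)) /= h.
apply: cvg_trans (h _); last by split => //; rewrite in_itv.
apply: cvg_app; apply: within_subset => -[s y] /= [sT Oy].
by split => //; exact: subset_closure.
Qed.

Lemma C21_ext f : smooth_C21 Omega T f -> ext f.
Proof. by move=> hf t x tT cx; apply/cvg_ex; exists (f t x); exact: C21_limit. Qed.

Lemma C21_trace f t x : smooth_C21 Omega T f -> 0 <= t <= T -> closure Omega x ->
  trace Omega (f t) x = f t x.
Proof. by move=> hf tT cx; apply: trace_unique => //; exact: slice_cvg (C21_limit _ _ _). Qed.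

Lemma C21_C1 f t : smooth_C21 Omega T f -> 0 <= t <= T -> C1_closure Omega (f t).
Proof.
move=> hf tT; split; first exact: extends_traced (C21_ext hf) tT.
move=> i; split; first by move=> x Ox; exact: (C21_pd hf tT Ox).
exact: extends_traced (C21_pd_cont hf (i := i)) tT.
Qed.

Lemma C21_C1_pd f t i : smooth_C21 Omega T f -> 0 <= t <= T ->
  C1_closure Omega (pd i (f t)).
Proof.
move=> hf tT; split; first exact: extends_traced (C21_pd_cont hf (i := i)) tT.
move=> j; split; first by move=> x Ox; exact: (C21_pd2 hf tT Ox).
exact: extends_traced (C21_pd2_cont hf (i := j) (j := i)) tT.
Qed.

Lemma C21_tdiff f t : smooth_C21 Omega T f -> 0 <= t <= T ->
  tdiff Omega T t f (dt T f t).
Proof.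
move=> hf tT; apply: tdiff_of_dt => //; first exact: C21_ext.
- by move=> s x sT Ox; exact: (C21_dt hf sT Ox).
- exact: C21_dt_cont hf.
Qed.

Lemma mixed_tdiff_pd f t i : smooth_mixed Omega T f -> 0 <= t <= T ->
  tdiff Omega T t (fun s => pd i (f s)) (dt T (fun s => pd i (f s)) t).
Proof.
move=> hf tT; apply: tdiff_of_dt => //.
- exact: (C21_pd_cont (mixed_C21 hf) (i := i)).
- move=> s x sT Ox; exact: (mixed_dt_pd hf sT Ox).
- exact: (mixed_dt_pd_cont hf (i := i)).
Qed.

End smooth_fields.

(** * Integration by parts *)

Section integration_by_parts.
Context {R : realType} {d : nat} (Omega : set 'rV[R]_d).
Hypotheses (d_gt1 : (1 < d)%N) (reg : regular_domain Omega).
Implicit Types (w : 'rV[R]_d -> R) (G : 'I_d -> 'rV[R]_d -> R) (x : 'rV[R]_d).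

Lemma boundary_closure x : boundary Omega x -> closure Omega x.
Proof. by case. Qed.

(** Green's formula for the product of w with a vector field G whose flux
    through the boundary vanishes wherever w does not. *)
Lemma green_product w G : C1_closure Omega w -> (forall i, C1_closure Omega (G i)) ->
  (forall x, boundary Omega x ->
    trace Omega w x * \sum_i trace Omega (G i) x * normal Omega x 0 i = 0) ->
  vol_integral Omega (fun x => \sum_i pd i w x * G i x) =
  - vol_integral Omega (fun x => w x * \sum_i pd i (G i) x).
Proof.
move=> C1w C1G flux0.
have oO := domain_open reg; have bO := domain_bounded reg.
pose F x : 'rV[R]_d := \row_i (w x * G i x).
have FE i : (fun x => F x 0 i) = (fun x => w x * G i x).
  by apply/funext => x; rewrite mxE.
have divF : vol_integral Omega (div F) = 0.
  apply: (green_zero d_gt1 (domain_green reg)) => [i|x bx].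
    by rewrite FE; exact: C1M C1w (C1G i).
  have cx := boundary_closure bx.
  apply: etrans (flux0 x bx). rewrite mulr_sumr; apply: eq_bigr => i _.
  by rewrite FE traceM ?mulrA//; [exact: C1_traced C1w x cx|exact: C1_traced (C1G i) x cx].
apply/eqP; rewrite -addr_eq0 -vol_integralD//.
- apply/eqP; apply: etrans divF; apply: eq_vol_integral => x Ox.
  rewrite /div mulr_sumr -big_split/=; apply: eq_bigr => i _; rewrite FE.
  apply/esym/pd_val.
  exact: is_pdM (C1_derivable C1w Ox) (C1_derivable (C1G i) Ox).
- by apply: traced_sum => i; exact: tracedM (C1_traced_pd C1w) (C1_traced (C1G i)).
- apply: tracedM; first exact: C1_traced.
  by apply: traced_sum => i; exact: C1_traced_pd (C1G i).
Qed.

End integration_by_parts.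

(** * Strain and stress *)

Section tensor_algebra.
Context {R : realType} {d : nat}.
Implicit Types (A B P : 'M[R]_d) (a : R) (v : 'rV[R]_d).

Lemma enorm_sqr v : enorm v ^+ 2 = \sum_i v 0 i ^+ 2.
Proof.
rewrite sqr_sqrtr; last by apply: sumr_ge0 => i _; exact: sqr_ge0.
by [].
Qed.

Lemma ddotDl A B P : ddot (A + B) P = ddot A P + ddot B P.
Proof.
rewrite /ddot -big_split; apply: eq_bigr => i _; rewrite -big_split.
by apply: eq_bigr => j _; rewrite mxE mulrDl.
Qed.

Lemma ddotZl a A P : ddot (a *: A) P = a * ddot A P.
Proof.
rewrite /ddot mulr_sumr; apply: eq_bigr => i _; rewrite mulr_sumr.
by apply: eq_bigr => j _; rewrite mxE mulrA.
Qed.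

Lemma ddotC A B : ddot A B = ddot B A.
Proof. by apply: eq_bigr => i _; apply: eq_bigr => j _; rewrite mulrC. Qed.

Lemma ddot_scalar a P : ddot a%:M P = a * \tr P.
Proof.
rewrite /ddot mulr_sumr; apply: eq_bigr => i _.
rewrite (bigD1 i)//= big1 ?addr0 => [|j ji]; first by rewrite mxE eqxx mulr1n.
by rewrite mxE eq_sym (negbTE ji) mulr0n mul0r.
Qed.

Lemma ddot_tr A B : ddot A^T B^T = ddot A B.
Proof.
rewrite /ddot exchange_big; apply: eq_bigr => i _.
by apply: eq_bigr => j _; rewrite !mxE.
Qed.

Lemma ddot_sym P B : B^T = B -> ddot (2^-1 *: (P + P^T)) B = ddot P B.
Proof.
move=> sB; rewrite ddotZl ddotDl -{2}sB ddot_tr; lra.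
Qed.

Variables (u : 'rV[R]_d -> 'rV[R]_d) (x : 'rV[R]_d).

Lemma strain_sym : (strain u x)^T = strain u x.
Proof. by apply/matrixP => i j; rewrite !mxE addrC. Qed.

Lemma tr_strain : \tr (strain u x) = div u x.
Proof.
apply: eq_bigr => i _; rewrite mxE; lra.
Qed.

(** As a combination of squares, the density can be differentiated in time
    entry by entry with the product rule. *)
Lemma energy_densityE lambda mu : energy_density lambda mu u x =
  lambda * div u x ^+ 2 + 2 * mu * ddot (strain u x) (strain u x).
Proof. by rewrite /energy_density /stress ddotDl ddot_scalar ddotZl tr_strain mulrA. Qed.

(** The stress is symmetric, so its power against a gradient P only sees the
    symmetric part of P. *)
Lemma ddot_thermal_stress lambda mu beta Theta0 Th P :
  ddot P (thermal_stress lambda mu beta Theta0 u Th x) =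
  (lambda * div u x - beta * (Th x - Theta0)) * \tr P
  + 2 * mu * ddot (2^-1 *: (P + P^T)) (strain u x).
Proof.
rewrite ddot_sym ?strain_sym// ddotC /thermal_stress /stress -scaleN1r !ddotDl !ddotZl.
by rewrite !ddot_scalar (ddotC P); ring.
Qed.

End tensor_algebra.

(** * Time derivatives of the energies *)

Section energy_derivatives.
Context {R : realType} {d : nat} (Omega : set 'rV[R]_d) (T : R).
Hypotheses (d_gt1 : (1 < d)%N) (reg : regular_domain Omega).
Variable t : R.
Hypothesis tT : 0 <= t <= T.
Implicit Types (f g z : R -> 'rV[R]_d -> R) (x : 'rV[R]_d).

Let oO := domain_open reg.
Let bO := domain_bounded reg.

Lemma div_gradE (f : 'rV[R]_d -> R) x : div (grad f) x = \sum_i pd i (pd i f) x.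
Proof.
apply: eq_bigr => i _; congr (pd i _ x); apply/funext => y; exact: mxE.
Qed.

Lemma div_scale_gradE (k f : 'rV[R]_d -> R) x :
  div (fun y => k y *: grad f y) x = \sum_i pd i (fun y => k y * pd i f y) x.
Proof.
by apply: eq_bigr => i _; congr (pd i _ x); apply/funext => y; rewrite !mxE.
Qed.

Lemma ext_lap f : smooth_C21 Omega T f ->
  extends_continuously Omega T (fun s => div (grad (f s))).
Proof.
move=> hf; rewrite (_ : (fun s => _) = fun s x => \sum_i pd i (pd i (f s)) x).
  by apply: ext_sum => i; exact: (C21_pd2_cont hf (i := i) (j := i)).
by apply/funext => s; apply/funext => x; exact: div_gradE.
Qed.

Lemma traced_grad_sqr (f : 'rV[R]_d -> R) : (forall i, traced Omega (pd i f)) ->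
  traced Omega (fun x => enorm (grad f x) ^+ 2).
Proof.
move=> tf; rewrite (_ : (fun x => _) = fun x => \sum_i pd i f x * pd i f x).
  by apply: traced_sum => i; exact (tracedM (tf i) (tf i)).
by apply/funext => x; rewrite enorm_sqr; apply: eq_bigr => i _; rewrite mxE expr2.
Qed.

(** No time derivative of the gradient of z is available. As
    |a|^2 - |b|^2 = (a - b) . (a + b), Green's formula moves the gradient of
    z s - z t onto the other factor; the boundary term vanishes by the Neumann
    condition at both times. *)
Lemma dirichlet_tderive z : smooth_C21 Omega T z ->
  (forall s x, 0 <= s <= T -> boundary Omega x -> normal_derivative Omega (z s) x = 0) ->
  has_tderive T (fun s => vol_integral Omega (fun x => enorm (grad (z s) x) ^+ 2)) t
    (- 2 * vol_integral Omega (fun x => dt T z t x * div (grad (z t)) x)).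
Proof.
move=> hz zN.
pose lap s := div (grad (z s)).
have tlap s : 0 <= s <= T -> traced Omega (lap s).
  by move=> sT; exact: extends_traced (ext_lap hz) sT.
have tz' : traced Omega (dt T z t) by exact: extends_traced (C21_dt_cont hz) tT.
have tgrad s : 0 <= s <= T -> traced Omega (fun x => enorm (grad (z s) x) ^+ 2).
  by move=> sT; apply: traced_grad_sqr => i; exact: C1_traced (C21_C1_pd i hz sT).
have [tz jz qz] := C21_tdiff hz tT.
have jlap : jointly Omega T t lap (lap t) by exact: jointly_extends tT (ext_lap hz).
have jq := jointlyM qz (jointlyD jlap (jointly_cst T t (tlap t tT))).
have tq s : 0 <= s <= T -> s != t ->
    traced Omega (fun x => time_quotient (z ^~ x) t s * (lap s x + lap t x)).
  move=> sT _; apply: tracedM; last exact: tracedD (tlap s sT) (tlap t tT).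
  exact: traced_quotient (tz s sT) (tz t tT).
have lim c : vol_integral Omega (fun x => dt T z t x * (lap t x + lap t x)) = c ->
    vol_integral Omega (fun x => time_quotient (z ^~ x) t s * (lap s x + lap t x))
    @[s --> within `[0, T] t^'] --> c.
  by move=> <-; exact (vol_integral_cvg oO bO jq tq).
have /lim : vol_integral Omega (fun x => dt T z t x * (lap t x + lap t x)) =
    2 * vol_integral Omega (fun x => dt T z t x * div (grad (z t)) x).
  rewrite -(vol_integralZ oO bO); last exact: tracedM tz' (tlap t tT).
  by apply: eq_vol_integral => x _; rewrite /lap; ring.
move/cvgN; rewrite mulNr; apply: cvg_trans; apply: near_eq_cvg.
apply: near_time => s sT st.
have C1s := C21_C1 hz sT; have C1t := C21_C1 hz tT.
have C1ps i := C21_C1_pd i hz sT; have C1pt i := C21_C1_pd i hz tT.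
have C1w := C1B C1s C1t; have C1G i := C1D (C1ps i) (C1pt i).
have := @green_product _ _ _ d_gt1 reg (fun x => z s x - z t x)
  (fun i x => pd i (z s) x + pd i (z t) x) C1w C1G.
have flux0 x : boundary Omega x -> trace Omega (fun x => z s x - z t x) x *
    \sum_i trace Omega (fun x => pd i (z s) x + pd i (z t) x) x * normal Omega x 0 i = 0.
  move=> bx; have cx := boundary_closure bx.
  rewrite (_ : \sum_i _ = normal_derivative Omega (z s) x + normal_derivative Omega (z t) x).
    by rewrite !zN// addr0 mulr0.
  rewrite /normal_derivative -big_split; apply: eq_bigr => i _ /=.
  by rewrite -mulrDl traceD//; [exact: C1_traced (C1ps i) x cx|exact: C1_traced (C1pt i) x cx].
move=> /(_ flux0) green.
rewrite /time_quotient -(vol_integralB oO bO (tgrad s sT) (tgrad t tT)).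
rewrite (_ : vol_integral Omega (fun x => enorm _ ^+ 2 - _) =
  vol_integral Omega (fun x =>
    \sum_i pd i (fun x => z s x - z t x) x * (pd i (z s) x + pd i (z t) x))); last first.
  apply: eq_vol_integral => x Ox; rewrite !enorm_sqr -sumrB; apply: eq_bigr => i _.
  have /pd_val -> : is_derive x (delta_mx 0 i : 'rV[R]_d) (fun x => z s x - z t x)
      (pd i (z s) x - pd i (z t) x).
    have ds := is_derive_pd (C1_derivable (i := i) C1s Ox).
    exact: is_deriveB ds (is_derive_pd (C1_derivable C1t Ox)).
  by rewrite !mxE; ring.
rewrite green mulNr; congr (- _); rewrite mulrC -(vol_integralZ oO bO); last first.
  apply: tracedM (C1_traced C1w) _.
  by apply: traced_sum => i; exact: C1_traced_pd (C1G i).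
apply: eq_vol_integral => x Ox; rewrite /time_quotient mulrA [_ * _ ^-1]mulrC; congr (_ * _).
rewrite /lap !div_gradE -big_split; apply: eq_bigr => i _ /=; apply/esym/pd_val.
exact: is_pdD (C1_derivable (C1ps i) Ox) (C1_derivable (C1pt i) Ox).
Qed.

End energy_derivatives.

Section elastic_power.
Context {R : realType} {d : nat} (Omega : set 'rV[R]_d) (T : R).
Hypotheses (d_gt1 : (1 < d)%N) (reg : regular_domain Omega) (T0 : 0 < T).
Variable t : R.
Hypothesis tT : 0 <= t <= T.
Implicit Types (f g z : R -> 'rV[R]_d -> R) (x : 'rV[R]_d).

Let oO := domain_open reg.
Let bO := domain_bounded reg.

(** One row S of a divergence free stress, frozen at time t, is tested with the
    difference f s - f t: the integral of grad (f s) . S does not depend on s,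
    so its derivative at t is 0. *)
Lemma stress_power_eq0 f (S : 'I_d -> 'rV[R]_d -> R) :
  smooth_mixed Omega T f -> (forall j, C1_closure Omega (S j)) ->
  (forall x, Omega x -> \sum_j pd j (S j) x = 0) ->
  (forall s x, 0 <= s <= T -> boundary Omega x ->
    (f s x - f t x) * \sum_j trace Omega (S j) x * normal Omega x 0 j = 0) ->
  vol_integral Omega (fun x => \sum_j dt T (fun s => pd j (f s)) t x * S j x) = 0.
Proof.
move=> hf C1S divS flux0; have hf2 := mixed_C21 hf.
pose K s x := \sum_j pd j (f s) x * S j x.
have tK : tdiff Omega T t K (fun x => \sum_j dt T (fun s => pd j (f s)) t x * S j x).
  have tj j := tdiffM tT (mixed_tdiff_pd j hf tT) (tdiff_cst T t (C1_traced (C1S j))).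
  apply: tdiff_ext tT _ _ (tdiff_sum tj) => // x _.
  by apply: eq_bigr => j _; rewrite mulr0 addr0.
apply: (has_tderive_unique T0 tT (tdiff_integral oO bO tT tK)).
apply: has_tderive_ext tT _ (has_tderive_cst T t (vol_integral Omega (K t))) => s sT.
have C1s := C21_C1 hf2 sT; have C1t := C21_C1 hf2 tT.
have C1w := C1B C1s C1t.
have [tKs _ _] := tK.
apply/esym/eqP; rewrite -subr_eq0 -(vol_integralB oO bO (tKs s sT) (tKs t tT)); apply/eqP.
have flux x : boundary Omega x -> trace Omega (fun x => f s x - f t x) x *
    \sum_j trace Omega (S j) x * normal Omega x 0 j = 0.
  move=> bx; apply: etrans (flux0 s x sT bx); congr (_ * _).
  have cx := boundary_closure bx; apply: trace_unique => //.
  have fs := slice_cvg sT (C21_limit hf2 sT cx).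
  exact: cvgB fs (slice_cvg tT (C21_limit hf2 tT cx)).
have green := green_product d_gt1 reg C1w C1S flux.
transitivity (vol_integral Omega (fun x => \sum_j pd j (fun x => f s x - f t x) x * S j x)).
  apply: eq_vol_integral => x Ox; rewrite -sumrB; apply: eq_bigr => j _.
  have /pd_val -> : is_derive x (delta_mx 0 j : 'rV[R]_d) (fun x => f s x - f t x)
      (pd j (f s) x - pd j (f t) x).
    have ds := is_derive_pd (C1_derivable (i := j) C1s Ox).
    exact: is_deriveB ds (is_derive_pd (C1_derivable C1t Ox)).
  by rewrite mulrBl.
apply: (etrans green); apply/eqP; rewrite oppr_eq0; apply/eqP.
apply: etrans (vol_integral_cst0 oO); by apply: eq_vol_integral => x Ox; rewrite divS// mulr0.
Qed.

Section balance.
Variables (lambda mu beta Theta0 : R).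
Variables (u : R -> 'rV[R]_d -> 'rV[R]_d) (Theta z : R -> 'rV[R]_d -> R).
Hypotheses (hu : forall i, smooth_mixed Omega T (fun s x => u s x 0 i))
  (hTh : smooth_C21 Omega T Theta) (hz : smooth_C21 Omega T z).

Local Notation sigma := (thermal_stress lambda mu beta Theta0 (u t) (Theta t)).

(** The entries are time derivatives of the space derivatives of u. They are not
    known to be space derivatives of the velocity. *)
Definition disp_grad_rate x : 'M[R]_d :=
  \matrix_(i, j) dt T (fun s => pd j (fun y => u s y 0 i)) t x.

Definition strain_rate x : 'M[R]_d := 2^-1 *: (disp_grad_rate x + (disp_grad_rate x)^T).

Lemma tdiff_pd_u i j : tdiff Omega T t (fun s => pd j (fun y => u s y 0 i))
  (fun x => disp_grad_rate x i j).
Proof.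
apply: tdiff_ext tT _ _ (mixed_tdiff_pd j (hu i) tT) => // x _.
by rewrite mxE.
Qed.

Lemma tdiff_div : tdiff Omega T t (fun s => div (u s)) (fun x => \tr (disp_grad_rate x)).
Proof. exact: tdiff_sum (fun i => tdiff_pd_u i i). Qed.

Lemma dt_div x : Omega x -> dt T (fun s => div (u s)) t x = \tr (disp_grad_rate x).
Proof.
move=> Ox; rewrite /dt (_ : (fun s => _) = fun s => \sum_i pd i (fun y => u s y 0 i) x) //.
rewrite tderive_sum//; first by apply: eq_bigr => i _; rewrite mxE.
by move=> i; exact: (mixed_dt_pd (hu i) tT Ox).
Qed.

Lemma tdiff_strain i j : tdiff Omega T t (fun s x => strain (u s) x i j)
  (fun x => strain_rate x i j).
Proof.
apply: tdiff_ext tT _ _ (tdiffZ 2^-1 tT (tdiffD (tdiff_pd_u i j) (tdiff_pd_u j i))).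
  by move=> s x _ _; rewrite mxE.
by move=> x _; rewrite !mxE.
Qed.

Lemma tdiff_energy_density : tdiff Omega T t (fun s => energy_density lambda mu (u s))
  (fun x => 2 * (lambda * div (u t) x * \tr (disp_grad_rate x)
                 + 2 * mu * ddot (strain_rate x) (strain (u t) x))).
Proof.
have tD := tdiffZ lambda tT (tdiffM tT tdiff_div tdiff_div).
have tE := tdiffZ (2 * mu) tT (tdiff_sum (fun i => tdiff_sum (fun j =>
  tdiffM tT (tdiff_strain i j) (tdiff_strain i j)))).
apply: tdiff_ext tT _ _ (tdiffD tD tE).
  by move=> s x _ _; rewrite energy_densityE expr2.
move=> x _.
rewrite (_ : \sum_i _ = ddot (strain_rate x) (strain (u t) x) +
                        ddot (strain (u t) x) (strain_rate x)).
  by rewrite (ddotC (strain _ _)); ring.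
rewrite /ddot -big_split; apply: eq_bigr => i _; rewrite -big_split.
by apply: eq_bigr.
Qed.

Lemma C1_thermal_stress i j : C1_closure Omega (fun x => sigma x i j).
Proof.
have C1p k l : C1_closure Omega (pd k (fun y => u t y 0 l)).
  exact: C21_C1_pd k (mixed_C21 (hu l)) tT.
have C1dv := C1Z (lambda * (i == j)%:R) (C1_sum (fun k => C1p k k)).
have C1e := C1Z (2 * mu) (C1Z 2^-1 (C1D (C1p j i) (C1p i j))).
have C1T := C1Z (beta * (i == j)%:R) (C1B (C21_C1 hTh tT) (C1_cst Omega Theta0)).
rewrite (_ : (fun x => _) = fun x => lambda * (i == j)%:R * div (u t) x +
    2 * mu * (2^-1 * (pd j (fun y => u t y 0 i) x + pd i (fun y => u t y 0 j) x))
    - beta * (i == j)%:R * (Theta t x - Theta0)).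
  exact (C1B (C1D C1dv C1e) C1T).
apply/funext => x; rewrite /thermal_stress /stress !mxE.
by case: (i == j); rewrite ?mulr1n ?mulr0n; ring.
Qed.

Hypothesis equilibrium : forall x, Omega x ->
  divM (fun y => (1 - z t y) ^+ 2 *: sigma y) x = 0.
Hypothesis clamped_or_free : forall s x, 0 <= s <= T -> boundary Omega x ->
  u s x = u t x \/ normal_flux Omega sigma x = 0.

(** The equilibrium equation in weak form: the i-th row of the stress
    against the i-th component of the displacement rate, summed over i. *)
Lemma stress_power_sum_eq0 : vol_integral Omega
  (fun x => (1 - z t x) ^+ 2 * ddot (disp_grad_rate x) (sigma x)) = 0.
Proof.
pose S i j x := (1 - z t x) ^+ 2 * sigma x i j.
have C1a : C1_closure Omega (fun x => (1 - z t x) ^+ 2).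
  have C1m := C1B (C1_cst Omega 1) (C21_C1 hz tT).
  exact (C1M C1m C1m).
have C1S i j : C1_closure Omega (S i j) by exact: C1M C1a (C1_thermal_stress i j).
have tP i j : traced Omega (fun x => disp_grad_rate x i j).
  by have [_ _ []] := tdiff_pd_u i j.
have tPS i : traced Omega (fun x => \sum_j disp_grad_rate x i j * S i j x).
  by apply: traced_sum => j; exact: tracedM (tP i j) (C1_traced (C1S i j)).
transitivity (vol_integral Omega (fun x => \sum_i \sum_j disp_grad_rate x i j * S i j x)).
  apply: eq_vol_integral => x _; rewrite mulr_sumr; apply: eq_bigr => i _.
  by rewrite mulr_sumr; apply: eq_bigr => j _; rewrite /S; ring.
rewrite (vol_integral_sum oO bO tPS); apply: big1 => i _.
apply: etrans (stress_power_eq0 (hu i) (C1S i) _ _).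
- by apply: eq_vol_integral => x _; apply: eq_bigr => j _; rewrite mxE.
- move=> x Ox; have := congr1 (fun v : 'rV[R]_d => v 0 i) (equilibrium Ox).
  rewrite !mxE => E; apply: etrans E; apply: eq_bigr => j _; congr (pd j _ x).
  by apply/funext => y; rewrite mxE [RHS]mxE.
- move=> s x sT bx; have cx := boundary_closure bx.
  have [->|flux] := clamped_or_free sT bx; first by rewrite subrr mul0r.
  apply/eqP; rewrite mulf_eq0; apply/orP; right; apply/eqP.
  transitivity (trace Omega (fun y => (1 - z t y) ^+ 2) x * normal_flux Omega sigma x 0 i).
    rewrite mxE mulr_sumr; apply: eq_bigr => j _; rewrite mulrA; congr (_ * _).
    exact (traceM cx (C1_traced C1a cx) (C1_traced (C1_thermal_stress i j) cx)).
  by rewrite flux mxE mulr0.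
Qed.

Lemma elastic_tderive :
  has_tderive T (fun s => elastic_energy Omega lambda mu (u s) (z s)) t
    (beta * vol_integral Omega (fun x => (1 - z t x) ^+ 2 * (Theta t x - Theta0) *
        \tr (disp_grad_rate x))
     - vol_integral Omega (fun x => (1 - z t x) * energy_density lambda mu (u t) x *
        dt T z t x)).
Proof.
have tzd := C21_tdiff hz tT.
have tz1 := tdiffD (tdiff_cst T t (traced_cst Omega 1)) (tdiffZ (-1) tT tzd).
have tA := tdiffM tT tz1 tz1.
have tAW := tdiffM tT tA tdiff_energy_density.
have Ez s x : 1 + -1 * z s x = 1 - z s x by rewrite mulN1r.
pose W x := energy_density lambda mu (u t) x.
pose p x := ddot (disp_grad_rate x) (sigma x).
pose rate x := lambda * div (u t) x * \tr (disp_grad_rate x)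
    + 2 * mu * ddot (strain_rate x) (strain (u t) x).
have tI : tdiff Omega T t (fun s x => (1 - z s x) ^+ 2 * energy_density lambda mu (u s) x)
    (fun x => 2 * ((1 - z t x) ^+ 2 * rate x - (1 - z t x) * W x * dt T z t x)).
  apply: tdiff_ext tT _ _ tAW => [s x _ _|x _]; first by rewrite Ez expr2.
  by rewrite !Ez /W /rate; ring.
have t1 : traced Omega (fun x => (1 - z t x) ^+ 2).
  have C1m := C1B (C1_cst Omega 1) (C21_C1 hz tT).
  exact (C1_traced (C1M C1m C1m)).
have tD : traced Omega (fun x => \tr (disp_grad_rate x)) by have [_ _ []] := tdiff_div.
have tz' : traced Omega (dt T z t) by have [_ _ []] := tzd.
have tW : traced Omega W by have [+ _ _] := tdiff_energy_density; exact.
have tm : traced Omega (fun x => 1 - z t x).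
  exact: C1_traced (C1B (C1_cst Omega 1) (C21_C1 hz tT)).
have tTh : traced Omega (fun x => Theta t x - Theta0).
  exact: C1_traced (C1B (C21_C1 hTh tT) (C1_cst Omega Theta0)).
have tp : traced Omega p.
  apply: traced_sum => i; apply: traced_sum => j; apply: tracedM.
    by have [_ _ []] := tdiff_pd_u i j.
  exact: C1_traced (C1_thermal_stress i j).
have tg := tracedM (tracedM t1 tTh) tD.
have tw := tracedM (tracedM tm tW) tz'.
have tpp := tracedM t1 tp.
pose g x := (1 - z t x) ^+ 2 * (Theta t x - Theta0) * \tr (disp_grad_rate x).
pose w x := (1 - z t x) * W x * dt T z t x.
pose q x := (1 - z t x) ^+ 2 * p x.
have tbg : traced Omega (fun x => beta * g x) by exact (tracedM (traced_cst Omega beta) tg).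
(* the elastic power is that of the thermal stress, plus the work of the
   thermal pressure that the thermal stress subtracts *)
have rateE x : 2 * ((1 - z t x) ^+ 2 * rate x - w x) = 2 * ((beta * g x - w x) + q x).
  by rewrite /q /p ddot_thermal_stress /g /rate -/(strain_rate x); ring.
have total : vol_integral Omega (fun x => 2 * ((1 - z t x) ^+ 2 * rate x - w x)) =
    2 * (beta * vol_integral Omega g - vol_integral Omega w).
  transitivity (vol_integral Omega (fun x => 2 * ((beta * g x - w x) + q x))).
    by apply: eq_vol_integral => x _; exact: rateE.
  rewrite (vol_integralZ oO bO 2 (tracedD (tracedB tbg tw) tpp)).
  rewrite (vol_integralD oO bO (tracedB tbg tw) tpp) stress_power_sum_eq0 addr0.
  by rewrite (vol_integralB oO bO tbg tw) (vol_integralZ oO bO beta tg).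
have := has_tderiveZ (c := 2^-1) (tdiff_integral oO bO tT tI).
by rewrite total mulrA mulVf ?mul1r// pnatr_eq0.
Qed.

End balance.
End elastic_power.

Section scalar_fields.
Context {R : realType} {d : nat} (Omega : set 'rV[R]_d) (T : R).
Hypotheses (d_gt1 : (1 < d)%N) (reg : regular_domain Omega).
Variable t : R.
Hypothesis tT : 0 <= t <= T.
Implicit Types (f g z Theta : R -> 'rV[R]_d -> R) (x : 'rV[R]_d).

Let oO := domain_open reg.
Let bO := domain_bounded reg.

Lemma surface_tderive z gamma eps : eps != 0 -> smooth_C21 Omega T z ->
  (forall s x, 0 <= s <= T -> boundary Omega x -> normal_derivative Omega (z s) x = 0) ->
  has_tderive T (fun s => surface_energy Omega gamma eps (z s)) t
    (gamma / eps * vol_integral Omega (fun x => dt T z t x * z t x)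
     - eps * gamma * vol_integral Omega (fun x => dt T z t x * div (grad (z t)) x)).
Proof.
move=> eps0 hz zN; have tz := C21_tdiff hz tT.
have tzz := tdiffM tT tz tz.
have tz' : traced Omega (dt T z t) by have [_ _ []] := tz.
have tzt : traced Omega (z t) by have [+ _ _] := tz; exact.
have dz : has_tderive T (fun s => vol_integral Omega (fun x => z s x * z s x)) t
    (2 * vol_integral Omega (fun x => dt T z t x * z t x)).
  rewrite -(vol_integralZ oO bO 2 (tracedM tz' tzt)).
  apply: tdiff_integral oO bO tT _.
  by apply: tdiff_ext tT _ _ tzz => // x _; ring.
have dg := dirichlet_tderive d_gt1 reg tT hz zN.
have := has_tderiveD (has_tderiveZ (c := 2^-1 * gamma * eps) dg)
  (has_tderiveZ (c := 2^-1 * gamma / eps) dz).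
set l := (X in has_tderive _ _ _ X -> _).
have -> : l = gamma / eps * vol_integral Omega (fun x => dt T z t x * z t x)
     - eps * gamma * vol_integral Omega (fun x => dt T z t x * div (grad (z t)) x).
  by rewrite /l; field.
apply: has_tderive_ext tT _ => s sT.
have tg : traced Omega (fun x => enorm (grad (z s) x) ^+ 2).
  by apply: traced_grad_sqr => i; exact: C1_traced (C21_C1_pd i hz sT).
have tzs : traced Omega (fun x => z s x * z s x) by have [+ _ _] := tzz; exact.
have tG := tracedM (traced_cst Omega (gamma * eps)) tg.
have tZ := tracedM (traced_cst Omega (gamma / eps)) tzs.
transitivity (2^-1 * vol_integral Omega (fun x =>
    gamma * eps * enorm (grad (z s) x) ^+ 2 + gamma / eps * (z s x * z s x))).
  rewrite (vol_integralD oO bO tG tZ).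
  by rewrite (vol_integralZ oO bO _ tg) (vol_integralZ oO bO _ tzs); ring.
congr (_ * _); apply: eq_vol_integral => x _.
by rewrite real_normK ?num_real//; field.
Qed.

Lemma thermal_tderive Theta (chi Theta0 : R) : Theta0 != 0 -> smooth_C21 Omega T Theta ->
  has_tderive T (fun s => thermal_energy Omega chi Theta0 (Theta s)) t
    (chi / Theta0 * vol_integral Omega (fun x => dt T Theta t x * (Theta t x - Theta0))).
Proof.
move=> Th0 hTh; have tTh := C21_tdiff hTh tT.
have tm := tdiffD tTh (tdiff_cst T t (traced_cst Omega (- Theta0))).
have [_ _ [tTh' _]] := tTh.
have tmt : traced Omega (fun x => Theta t x - Theta0) by have [+ _ _] := tm; exact.
have tmm : tdiff Omega T t (fun s x => `|Theta s x - Theta0| ^+ 2)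
    (fun x => 2 * (dt T Theta t x * (Theta t x - Theta0))).
  apply: tdiff_ext tT _ _ (tdiffM tT tm tm) => [s x _ _|x _].
    by rewrite real_normK ?num_real// expr2.
  by ring.
have := has_tderiveZ (c := chi / (2 * Theta0)) (tdiff_integral oO bO tT tmm).
rewrite (vol_integralZ oO bO 2 (tracedM tTh' tmt)).
set l := (X in has_tderive _ _ _ X -> _).
suff -> : l = chi / Theta0 *
  vol_integral Omega (fun x => dt T Theta t x * (Theta t x - Theta0)) by [].
by rewrite /l; field.
Qed.

(** The boundary term (Th - Theta0) k dTh/dn vanishes: the first factor where
    Theta0 is prescribed, the last one elsewhere. *)
Lemma conduction_by_parts (k Th : 'rV[R]_d -> R) (Theta0 : R) :
  C1_closure Omega k -> C1_closure Omega Th ->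
  (forall i, C1_closure Omega (pd i Th)) ->
  (forall x, boundary Omega x ->
     trace Omega Th x = Theta0 \/ normal_derivative Omega Th x = 0) ->
  vol_integral Omega (fun x => (Th x - Theta0) * div (fun y => k y *: grad Th y) x) =
  - vol_integral Omega (fun x => k x * enorm (grad Th x) ^+ 2).
Proof.
move=> C1k C1Th C1p bc.
have C1w := C1B C1Th (C1_cst Omega Theta0).
have C1G i := C1M C1k (C1p i).
have flux x : boundary Omega x -> trace Omega (fun x => Th x - Theta0) x *
   \sum_i trace Omega (fun x => k x * pd i Th x) x * normal Omega x 0 i = 0.
  move=> bx; have cx := boundary_closure bx.
  have [ThE|nd] := bc x bx.
    have h : (Th y - Theta0) @[y --> within Omega (nbhs x)] --> trace Omega Th x - Theta0.
      by apply: cvgB; [exact: C1_traced C1Th x cx|exact: cvg_cst].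
    by rewrite (trace_unique cx h) ThE subrr mul0r.
  apply/eqP; rewrite mulf_eq0; apply/orP; right; apply/eqP.
  transitivity (trace Omega k x * normal_derivative Omega Th x); last by rewrite nd mulr0.
  rewrite mulr_sumr; apply: eq_bigr => i _; rewrite mulrA; congr (_ * _).
  exact (traceM cx (C1_traced C1k cx) (C1_traced (C1p i) cx)).
have green := green_product d_gt1 reg C1w C1G flux.
have dissipation : vol_integral Omega
    (fun x => \sum_i pd i (fun x => Th x - Theta0) x * (k x * pd i Th x)) =
    vol_integral Omega (fun x => k x * enorm (grad Th x) ^+ 2).
  apply: eq_vol_integral => x Ox; rewrite enorm_sqr mulr_sumr; apply: eq_bigr => i _.
  have /pd_val -> : is_derive x (delta_mx 0 i : 'rV[R]_d) (fun x => Th x - Theta0)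
      (pd i Th x - 0).
    exact: is_deriveB (is_derive_pd (C1_derivable C1Th Ox)) (is_derive_cst _ _ _).
  by rewrite mxE; ring.
have divE : vol_integral Omega (fun x => (Th x - Theta0) * div (fun y => k y *: grad Th y) x) =
    vol_integral Omega (fun x => (Th x - Theta0) * \sum_i pd i (fun x => k x * pd i Th x) x).
  by apply: eq_vol_integral => x _; congr (_ * _); exact: div_scale_gradE.
apply: (etrans divE); apply: (etrans (esym (opprK _))).
exact (congr1 -%R (etrans (esym green) dissipation)).
Qed.

Lemma div_const_gradE (c : R) (f : 'rV[R]_d -> R) x :
  (forall i, derivable (pd i f) x (delta_mx 0 i)) ->
  div (fun y => c *: grad f y) x = c * div (grad f) x.
Proof.
move=> df; rewrite (div_scale_gradE (fun=> c)) div_gradE mulr_sumr.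
apply: eq_bigr => i _; apply: etrans (pd_val (is_pdM (derivable_cst _ _ _) (df i))) _.
by rewrite pd_cst mul0r add0r.
Qed.

(** The heat flux divergence expanded by the product rule; this expression,
    unlike the original one, is visibly continuous in space and time. *)
Lemma ext_conduction (kappa : R -> R) z Theta : (forall s, derivable kappa s 1) ->
  continuous (derive1 kappa) -> smooth_C21 Omega T z -> smooth_C21 Omega T Theta ->
  extends_continuously Omega T
    (fun s x => \sum_i (derive1 kappa (z s x) * pd i (z s) x * pd i (Theta s) x
                        + kappa (z s x) * pd i (pd i (Theta s)) x)).
Proof.
move=> dk ck' hz hTh.
have ck : continuous kappa.
  by move=> s; apply: differentiable_continuous; apply/derivable1_diffP.
apply: ext_sum => i.
have e1 := ext_comp ck' (C21_ext hz); have e2 := ext_comp ck (C21_ext hz).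
have e3 := C21_pd_cont hz (i := i); have e4 := C21_pd_cont hTh (i := i).
have e5 := C21_pd2_cont hTh (i := i) (j := i).
exact (extD (extM (extM e1 e3) e4) (extM e2 e5)).
Qed.

Lemma conductionE (kappa : R -> R) z Theta s x : (forall s, derivable kappa s 1) ->
  smooth_C21 Omega T z -> smooth_C21 Omega T Theta -> 0 <= s <= T -> Omega x ->
  div (fun y => kappa (z s y) *: grad (Theta s) y) x =
  \sum_i (derive1 kappa (z s x) * pd i (z s) x * pd i (Theta s) x
                        + kappa (z s x) * pd i (pd i (Theta s)) x).
Proof.
move=> dk hz hTh sT Ox; rewrite div_scale_gradE; apply: eq_bigr => i _.
have [dkz kzE] := is_derive_line_comp (dk (z s x)) (C1_derivable (i := i) (C21_C1 hz sT) Ox).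
have pdk : pd i (fun y => kappa (z s y)) x = derive1 kappa (z s x) * pd i (z s) x := kzE.
by rewrite -pdk; exact (pd_val (is_pdM dkz (C1_derivable (C21_C1_pd i hTh sT) Ox))).
Qed.

End scalar_fields.

(** * The energy balance *)

(** Multiplying by v replaces the positive part of B by B: where B is negative,
    v vanishes. *)
Lemma positive_part_sqr {R : realType} (alpha v B : R) : alpha != 0 ->
  alpha * v = Num.max B 0 -> alpha * v ^+ 2 = v * B.
Proof.
move=> alpha0 vB; have [B0|B0] := leP B 0; last first.
  by rewrite expr2 mulrA vB max_l ?ltW// mulrC.
move: vB; rewrite max_r// => /eqP.
by rewrite mulf_eq0 (negbTE alpha0) => /eqP ->; rewrite expr0n mulr0 mul0r.
Qed.

Theorem theorem3p3 (R : realType) (d : nat) (hd : d = 2%N \/ d = 3%N)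
  (Omega : set 'rV[R]_d) (hOmega : regular_domain Omega)
  (T : R) (hT : 0 < T)
  (GammaDu GammaNu GammaDT GammaNT : set 'rV[R]_d)
  (hGu : boundary Omega = GammaDu `|` GammaNu)
  (hGu0 : GammaDu `&` GammaNu = set0)
  (hGT : boundary Omega = GammaDT `|` GammaNT)
  (hGT0 : GammaDT `&` GammaNT = set0)
  (hGDu : (0 < hausdorff d.-1 GammaDu)%E)
  (mu lambda aL beta Theta0 chi alpha eps gamma : R)
  (hmu : 0 < mu) (hlambda : - (2 * mu / d%:R) < lambda) (haL : 0 < aL)
  (hbeta : beta = aL * (d%:R * lambda + 2 * mu))
  (hTheta0 : 0 < Theta0) (hchi : 0 < chi) (halpha : 0 < alpha)
  (heps : 0 < eps) (hgamma : 0 < gamma)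
  (kappa : R -> R) (hkappa : forall s : R, 0 <= s <= 1 -> 0 < kappa s)
  (hkappaC1 : (forall s : R, derivable kappa s 1) /\ continuous (derive1 kappa))
  (uD : R -> 'rV[R]_d -> 'rV[R]_d) (ThetaD : R -> 'rV[R]_d -> R)
  (zstar Thetastar : 'rV[R]_d -> R)
  (u : R -> 'rV[R]_d -> 'rV[R]_d) (Theta z : R -> 'rV[R]_d -> R)
  (hz01 : forall (t : R) (x : 'rV[R]_d), 0 <= t <= T -> closure Omega x -> 0 <= z t x <= 1)
  (hu_smooth : forall i, smooth_mixed Omega T (fun t x => u t x 0 i))
  (hz_smooth : smooth_C21 Omega T z)
  (hTheta_smooth : smooth_C21 Omega T Theta)
  (hu_eq : forall (t : R) (x : 'rV[R]_d), 0 <= t <= T -> Omega x ->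
    - divM (fun y => (1 - z t y) ^+ 2 *:
              thermal_stress lambda mu beta Theta0 (u t) (Theta t) y) x = 0)
  (hz_eq : forall (t : R) (x : 'rV[R]_d), 0 <= t <= T -> Omega x ->
    alpha * dt T z t x =
    Num.max (eps * div (fun y => gamma *: grad (z t) y) x
             - gamma / eps * z t x
             + (1 - z t x) * energy_density lambda mu (u t) x) 0)
  (hTheta_eq : forall (t : R) (x : 'rV[R]_d), 0 < t <= T -> Omega x ->
    chi * dt T Theta t x =
    div (fun y => kappa (z t y) *: grad (Theta t) y) x
    - Theta0 * (1 - z t x) ^+ 2 * beta * dt T (fun s => div (u s)) t x)
  (hu_D : forall (t : R) (x : 'rV[R]_d), 0 <= t <= T -> GammaDu x -> u t x = uD t x)
  (hu_N : forall (t : R) (x : 'rV[R]_d), 0 <= t <= T -> GammaNu x ->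
    normal_flux Omega
      (thermal_stress lambda mu beta Theta0 (u t) (Theta t)) x = 0)
  (hTheta_D : forall (t : R) (x : 'rV[R]_d), 0 <= t <= T -> GammaDT x -> Theta t x = ThetaD t x)
  (hTheta_N : forall (t : R) (x : 'rV[R]_d), 0 <= t <= T -> GammaNT x ->
    normal_derivative Omega (Theta t) x = 0)
  (hz_N : forall (t : R) (x : 'rV[R]_d), 0 <= t <= T -> boundary Omega x ->
    normal_derivative Omega (z t) x = 0)
  (hz_0 : forall x : 'rV[R]_d, Omega x -> z 0 x = zstar x)
  (hTheta_0 : forall x : 'rV[R]_d, Omega x -> Theta 0 x = Thetastar x)
  (huD_const : forall (t s : R) (x : 'rV[R]_d), 0 <= t <= T -> 0 <= s <= T -> GammaDu x ->
    uD t x = uD s x)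
  (hThetaD_const : forall (t : R) (x : 'rV[R]_d), 0 <= t <= T -> GammaDT x -> ThetaD t x = Theta0) :
  forall t : R, 0 <= t <= T ->
    let rhs := - Theta0^-1 * vol_integral Omega
                   (fun x => kappa (z t x) * enorm (grad (Theta t) x) ^+ 2)
               - alpha * vol_integral Omega (fun x => `|dt T z t x| ^+ 2) in
    has_tderive T (fun s => elastic_energy Omega lambda mu (u s) (z s)
                            + surface_energy Omega gamma eps (z s)
                            + thermal_energy Omega chi Theta0 (Theta s)) t rhs
    /\ rhs <= 0.
Proof.
move=> t tT rhs.
have d_gt1 : (1 < d)%N by case: hd => ->.
have [oO bO] := (domain_open hOmega, domain_bounded hOmega).
have [dkappa ckappa'] := hkappaC1.
have [eps_neq0 Theta0_neq0] : eps != 0 /\ Theta0 != 0 by split; exact: lt0r_neq0.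
have subO x : Omega x -> closure Omega x by exact: subset_closure.
(* a Dirichlet datum constant in time keeps u fixed; where u is free the traction vanishes *)
have bcu s x : 0 <= s <= T -> boundary Omega x -> u s x = u t x \/
    normal_flux Omega (thermal_stress lambda mu beta Theta0 (u t) (Theta t)) x = 0.
  move=> sT; rewrite hGu => -[xD|xN]; last by right; exact: hu_N.
  by left; rewrite !hu_D//; exact: huD_const.
have bcTheta x : boundary Omega x ->
    trace Omega (Theta t) x = Theta0 \/ normal_derivative Omega (Theta t) x = 0.
  move=> bx; have cx := boundary_closure bx.
  move: (bx); rewrite hGT => -[xD|xN]; last by right; exact: hTheta_N.
  by left; rewrite (C21_trace hTheta_smooth tT cx) hTheta_D// hThetaD_const.
have equilibrium x : Omega x -> divM (fun y => (1 - z t y) ^+ 2 *: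
    thermal_stress lambda mu beta Theta0 (u t) (Theta t) y) x = 0.
  by move=> Ox; apply/eqP; rewrite -oppr_eq0 hu_eq.
(* the heat equation is assumed for positive times and extends to t = 0 by
   continuity of all its terms *)
pose D s x := \tr (disp_grad_rate T s u x).
pose cond s x := \sum_i (derive1 kappa (z s x) * pd i (z s) x * pd i (Theta s) x
                        + kappa (z s x) * pd i (pd i (Theta s)) x).
have heat x : Omega x -> chi * dt T Theta t x =
    div (fun y => kappa (z t y) *: grad (Theta t) y) x
    - Theta0 * (1 - z t x) ^+ 2 * beta * D t x.
  move=> Ox.
  pose r s x := chi * dt T Theta s x - (cond s x
    - Theta0 * ((1 - z s x) * (1 - z s x)) * beta *
      \sum_i dt T (fun s => pd i (fun y => u s y 0 i)) s x).
  have rE s y : 0 <= s <= T -> Omega y -> r s y = chi * dt T Theta s y -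
      (div (fun y => kappa (z s y) *: grad (Theta s) y) y
       - Theta0 * (1 - z s y) ^+ 2 * beta * D s y).
    move=> sT Oy; rewrite /r (conductionE dkappa hz_smooth hTheta_smooth sT Oy) expr2.
    by congr (_ - (_ - _ * _)); apply: eq_bigr => i _; rewrite mxE.
  have r0 s : 0 < s -> s <= T -> r s x = 0.
    move=> s0 sT; have sT' : 0 <= s <= T by rewrite ltW.
    rewrite rE// hTheta_eq ?s0// (dt_div hT sT' hu_smooth Ox) subrr//.
  suff : r t x = 0 by rewrite rE// => /eqP; rewrite subr_eq0 => /eqP.
  have [t0|t0] := ltP 0 t; first by apply: r0 => //; case/andP: tT.
  have er : extends_continuously Omega T r.
    have ez := extB (ext_cst Omega T 1) (C21_ext hz_smooth).
    have eD := ext_sum (fun i => mixed_dt_pd_cont (hu_smooth i) (i := i)).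
    have ec := ext_conduction dkappa ckappa' hz_smooth hTheta_smooth.
    have e1 := extM (ext_cst Omega T chi) (C21_dt_cont hTheta_smooth).
    exact (extB e1 (extB ec (extM (extM (extM (ext_cst Omega T Theta0)
      (extM ez ez)) (ext_cst Omega T beta)) eD))).
  apply: (ext_eq0 oO hT tT Ox er) => s /andP[s0 sT] st; apply: r0 => //.
  rewrite lt_neqAle s0 andbT; apply: contra_neq st => <-.
  by apply/le_anti/andP; split => //; case/andP: tT.
pose W x := energy_density lambda mu (u t) x.
pose I_zW := vol_integral Omega (fun x => (1 - z t x) * W x * dt T z t x).
pose I_D := vol_integral Omega (fun x => (1 - z t x) ^+ 2 * (Theta t x - Theta0) * D t x).
pose I_lap := vol_integral Omega (fun x => dt T z t x * div (grad (z t)) x).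
pose I_z := vol_integral Omega (fun x => dt T z t x * z t x).
pose I_Th := vol_integral Omega (fun x => dt T Theta t x * (Theta t x - Theta0)).
pose I_cond := vol_integral Omega (fun x => kappa (z t x) * enorm (grad (Theta t) x) ^+ 2).
pose I_zz := vol_integral Omega (fun x => `|dt T z t x| ^+ 2).
have tz : traced Omega (z t) := C1_traced (C21_C1 hz_smooth tT).
have tz' : traced Omega (dt T z t) := extends_traced (C21_dt_cont hz_smooth) tT.
have tlap : traced Omega (div (grad (z t))) := extends_traced (ext_lap hz_smooth) tT.
have tW : traced Omega W.
  by have [+ _ _] := tdiff_energy_density tT lambda mu hu_smooth; exact.
have tm : traced Omega (fun x => 1 - z t x) := tracedB (traced_cst Omega 1) tz.
have tTh : traced Omega (fun x => Theta t x - Theta0) :=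
  tracedB (C1_traced (C21_C1 hTheta_smooth tT)) (traced_cst Omega Theta0).
have tTh' : traced Omega (dt T Theta t) := extends_traced (C21_dt_cont hTheta_smooth) tT.
have tD : traced Omega (D t) by have [_ _ []] := tdiff_div tT hu_smooth.
have C1k : C1_closure Omega (fun y => kappa (z t y)).
  exact (C1_comp dkappa ckappa' (C21_C1 hz_smooth tT)).
have tzlap := tracedM tz' tlap.
have tzz := tracedM tz' tz.
have tzW := tracedM (tracedM tm tW) tz'.
have tThD := tracedM (tracedM (tracedM tm tm) tTh) tD.
(* the damage equation tested with the time derivative of z *)
have damage : alpha * I_zz = eps * gamma * I_lap - gamma / eps * I_z + I_zW.
  have c1 := tracedM (traced_cst Omega (eps * gamma)) tzlap.
  have c2 := tracedM (traced_cst Omega (gamma / eps)) tzz.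
  transitivity (vol_integral Omega (fun x => eps * gamma * (dt T z t x * div (grad (z t)) x)
      - gamma / eps * (dt T z t x * z t x) + (1 - z t x) * W x * dt T z t x)).
    have tsqr : traced Omega (fun x => `|dt T z t x| ^+ 2).
      apply: traced_ext (tracedM tz' tz') => x _.
      by rewrite real_normK ?num_real// expr2.
    rewrite -(vol_integralZ oO bO alpha tsqr).
    apply: eq_vol_integral => x Ox; rewrite real_normK ?num_real//.
    rewrite (positive_part_sqr (lt0r_neq0 halpha) (hz_eq t x tT Ox)).
    rewrite div_const_gradE; first by rewrite /W; ring.
    by move=> i; exact: C1_derivable (C21_C1_pd i hz_smooth tT) Ox.
  rewrite (vol_integralD oO bO (tracedB c1 c2) tzW) (vol_integralB oO bO c1 c2).
  by rewrite (vol_integralZ oO bO _ tzlap) (vol_integralZ oO bO _ tzz).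
(* the heat equation tested with Theta - Theta0 *)
have temperature : chi * I_Th = - I_cond - Theta0 * beta * I_D.
  have tdiv : traced Omega (div (fun y => kappa (z t y) *: grad (Theta t) y)).
    have := extends_traced (ext_conduction dkappa ckappa' hz_smooth hTheta_smooth) tT.
    by apply: traced_ext => x Ox; rewrite (conductionE dkappa hz_smooth hTheta_smooth tT Ox).
  have green : vol_integral Omega (fun x => (Theta t x - Theta0) *
      div (fun y => kappa (z t y) *: grad (Theta t) y) x) = - I_cond.
    apply: (conduction_by_parts d_gt1 hOmega C1k (C21_C1 hTheta_smooth tT) _ bcTheta) => i.
    exact: C21_C1_pd i hTheta_smooth tT.
  have tTdiv := tracedM tTh tdiv.
  transitivity (vol_integral Omega (fun x => (Theta t x - Theta0) *
      div (fun y => kappa (z t y) *: grad (Theta t) y) x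
      - Theta0 * beta * ((1 - z t x) * (1 - z t x) * (Theta t x - Theta0) * D t x))).
    rewrite -(vol_integralZ oO bO chi (tracedM tTh' tTh)).
    by apply: eq_vol_integral => x Ox; rewrite mulrA heat//; ring.
  rewrite (vol_integralB oO bO tTdiv (tracedM (traced_cst Omega _) tThD)).
  have I_DE : vol_integral Omega (fun x =>
      (1 - z t x) * (1 - z t x) * (Theta t x - Theta0) * D t x) = I_D.
    by apply: eq_vol_integral => x _; rewrite expr2.
  rewrite (vol_integralZ oO bO _ tThD).
  exact (congr2 (fun a b => a - Theta0 * beta * b) green I_DE).
split.
  have dE := elastic_tderive d_gt1 hOmega hT tT hu_smooth
    hTheta_smooth hz_smooth equilibrium bcu.
  have dS := surface_tderive d_gt1 hOmega tT (gamma := gamma) eps_neq0 hz_smooth hz_N.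
  have dT := thermal_tderive hOmega tT (chi := chi) Theta0_neq0 hTheta_smooth.
  have -> : rhs = (beta * I_D - I_zW) + (gamma / eps * I_z - eps * gamma * I_lap)
      + chi / Theta0 * I_Th.
    rewrite /rhs -/I_cond -/I_zz damage.
    have -> : chi / Theta0 * I_Th = Theta0^-1 * (chi * I_Th) by ring.
    by rewrite temperature; field; rewrite ?eps_neq0 ?Theta0_neq0.
  exact (has_tderiveD (has_tderiveD dE dS) dT).
have cond_ge0 : 0 <= I_cond.
  apply: Rintegral_ge0 => x Ox; rewrite mulr_ge0 ?sqr_ge0// ltW//.
  by apply: hkappa; apply: hz01 => //; exact: subO.
have zz_ge0 : 0 <= I_zz by apply: Rintegral_ge0 => x _; exact: sqr_ge0.
rewrite /rhs -/I_cond -/I_zz mulNr -opprD oppr_le0.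
by rewrite addr_ge0 ?mulr_ge0 ?invr_ge0// ltW.
Qed.
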